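(* Let $(\widetilde A,\widetilde V)$ ($\widetilde A>0$) be a constant subcritical equilibrium, i.e. $\widetilde V^2<g\widetilde A H'(\widetilde A)$, and let $T$ satisfy $$T>L\max\Big\{\frac{1}{|\widetilde\lambda_1|},\frac{1}{\widetilde\lambda_2}\Big\},\qquad \widetilde\lambda_1=\widetilde V-\sqrt{g\widetilde AH'(\widetilde A)}<0<\widetilde\lambda_2=\widetilde V+\sqrt{g\widetilde AH'(\widetilde A)}.$$ Consider the mixed problem $$A_t+(AV)_x=0,\qquad V_t+S_x=0,$$ $$A(0,x)=A_0(x),\quad V(0,x)=V_0(x),\quad x\in[0,L],$$ $$S(t,0)-S(t,L)=h(t),\qquad Q(t,0)-Q(t,L)=\overline h(t).$$ If $\|(A_0-\widetilde A,V_0-\widetilde V)\|_{(C^1[0,L])^2}$ and $\|(h,\overline h)\|_{(C^1[0,T])^2}$ are sufficiently small, and the conditions of $C^1$ compatibility are satisfied at the points $(t,x)=(0,0)$ and $(0,L)$, then the initial data $(A_0,V_0)$ can be uniquely determined by the boundary observation $(\overline A(t),\overline V(t)):=(A(t,0),V(t,0))$, $t\in[0,T]$, together with the known boundary functions $(h(t),\overline h(t))$. Moreover, the following observability estimate holds: $$\|(A_0-\widetilde A,V_0-\widetilde V)\|_{(C^1[0,L])^2}\le C\big(\|(\overline A-\widetilde A,\overline V-\widetilde V)\|_{(C^1[0,T])^2}+\|(h,\overline h)\|_{(C^1[0,T])^2}\big),$$ where $C$ is a positive constant possibly depending on $T$ (but not on the data).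
   Context: Saint-Venant system for a horizontal cylindrical canal of length $L>0$: $A>0$ is the area of the wetted cross section, $V$ the average velocity, $S=\frac12V^2+gH(A)+gY$, where $g>0$ is the gravity constant, $Y$ is the (constant) altitude of the canal bed (one may take $Y=0$), and $H$, the depth of water, is a $C^1$ function of $A$ with $H'(A)>0$ for all $A>0$. $Q=AV$ denotes the flux. The conditions of $C^1$ compatibility mean that the two boundary conditions, and their first derivatives with respect to $t$, hold at $t=0$ when $(A,V)(0,x)$ is replaced by $(A_0,V_0)(x)$ and $(A_t,V_t)(0,x)$ is computed from the differential equations. ''Sufficiently small'' means bounded by some $\varepsilon>0$ possibly depending on $T$; $(A,V)$ is the unique $C^1$ solution of the mixed problem on $[0,T]\times[0,L]$ that is $C^1$-close to $(\widetilde A,\widetilde V)$. ''Uniquely determined'' means that two admissible initial data whose solutions (with the same $(h,\overline h)$) give the same observation on $[0,T]$ coincide.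
   Formalization: The derivative H' is additionally assumed Lipschitz in some neighbourhood of the equilibrium area (true for every C^2 function H); for H merely C^1 the observability estimate can fail. *)

(* Defs.v *)
From Stdlib Require Import Reals.
From Coquelicot Require Import Coquelicot.
Open Scope R_scope.

Definition Icc (a b x : R) : Prop := a <= x <= b.

Definition rect (T L : R) (p : R * R) : Prop :=
  Icc 0 T (fst p) /\ Icc 0 L (snd p).

Definition ex_derive_on (a b : R) (f : R -> R) (x : R) : Prop :=
  exists l : R, D_in f (fun _ => l) (Icc a b) x.

(* Derivative relative to [a,b], one-sided at the end points.  Like [Derive],
   it is total, and meaningful only under [ex_derive_on] (with a < b). *)
Definition Derive_on (a b : R) (f : R -> R) (x : R) : R :=
  iota (fun l : R => D_in f (fun _ => l) (Icc a b) x).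

Definition C1 (a b : R) (f : R -> R) : Prop :=
  (forall x, Icc a b x -> ex_derive_on a b f x) /\
  continuous_on (Icc a b) f /\
  continuous_on (Icc a b) (Derive_on a b f).

(* Functions on [0,T] x [0,L] take the time t first. *)
Definition Dt (T : R) (u : R -> R -> R) (t x : R) : R :=
  Derive_on 0 T (fun s => u s x) t.
Definition Dx (L : R) (u : R -> R -> R) (t x : R) : R :=
  Derive_on 0 L (fun y => u t y) x.

Definition C1_rect (T L : R) (u : R -> R -> R) : Prop :=
  (forall t x, rect T L (t, x) ->
     ex_derive_on 0 T (fun s => u s x) t /\ ex_derive_on 0 L (fun y => u t y) x) /\
  continuous_on (rect T L) (fun p => u (fst p) (snd p)) /\
  continuous_on (rect T L) (fun p => Dt T u (fst p) (snd p)) /\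
  continuous_on (rect T L) (fun p => Dx L u (fst p) (snd p)).

(* The supremum is finite for continuous f on compact D, the only case used. *)
Definition sup_norm {X : Type} (D : X -> Prop) (f : X -> R) : R :=
  real (Lub_Rbar (fun r => exists x, D x /\ r = Rabs (f x))).

Definition norm_C1 (a b : R) (f : R -> R) : R :=
  Rmax (sup_norm (Icc a b) f) (sup_norm (Icc a b) (Derive_on a b f)).

Definition norm_C1_2 (a b : R) (f1 f2 : R -> R) : R :=
  Rmax (norm_C1 a b f1) (norm_C1 a b f2).

Definition norm_C1_rect (T L : R) (u : R -> R -> R) : R :=
  Rmax (sup_norm (rect T L) (fun p => u (fst p) (snd p)))
    (Rmax (sup_norm (rect T L) (fun p => Dt T u (fst p) (snd p)))
          (sup_norm (rect T L) (fun p => Dx L u (fst p) (snd p)))).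

Definition S_fun (g Y : R) (H : R -> R) (a v : R) : R :=
  / 2 * v ^ 2 + g * H a + g * Y.

Definition lambda1 (g : R) (H : R -> R) (a v : R) : R :=
  v - sqrt (g * a * Derive H a).
Definition lambda2 (g : R) (H : R -> R) (a v : R) : R :=
  v + sqrt (g * a * Derive H a).

Definition mixed_problem_solution (g Y L T : R) (H A0 V0 h hb : R -> R)
    (A V : R -> R -> R) : Prop :=
  let S t x := S_fun g Y H (A t x) (V t x) in
  let Q t x := A t x * V t x in
  C1_rect T L A /\ C1_rect T L V /\
  (forall t x, rect T L (t, x) ->
     0 < A t x /\
     Dt T A t x + Dx L Q t x = 0 /\
     Dt T V t x + Dx L S t x = 0) /\
  (forall x, Icc 0 L x -> A 0 x = A0 x /\ V 0 x = V0 x) /\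
  (forall t, Icc 0 T t -> S t 0 - S t L = h t /\ Q t 0 - Q t L = hb t).

(* [At0], [Vt0] are the values of A_t, V_t at t = 0 given by the differential
   equations; [St0], [Qt0] are the resulting ones of
   S_t = V V_t + g H'(A) A_t and Q_t = V A_t + A V_t. *)
Definition C1_compatible (g Y L T : R) (H A0 V0 h hb : R -> R) : Prop :=
  let S0 x := S_fun g Y H (A0 x) (V0 x) in
  let Q0 x := A0 x * V0 x in
  let At0 x := - Derive_on 0 L Q0 x in
  let Vt0 x := - Derive_on 0 L S0 x in
  let St0 x := V0 x * Vt0 x + g * Derive H (A0 x) * At0 x in
  let Qt0 x := At0 x * V0 x + A0 x * Vt0 x in
  S0 0 - S0 L = h 0 /\
  Q0 0 - Q0 L = hb 0 /\
  St0 0 - St0 L = Derive_on 0 T h 0 /\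
  Qt0 0 - Qt0 L = Derive_on 0 T hb 0.

Definition small_compatible_data (g Y L T : R) (H : R -> R) (Ae Ve eps : R)
    (A0 V0 h hb : R -> R) : Prop :=
  C1 0 L A0 /\ C1 0 L V0 /\ C1 0 T h /\ C1 0 T hb /\
  norm_C1_2 0 L (fun x => A0 x - Ae) (fun x => V0 x - Ve) <= eps /\
  norm_C1_2 0 T h hb <= eps /\
  C1_compatible g Y L T H A0 V0 h hb.

Definition C1_close (T L Ae Ve delta : R) (A V : R -> R -> R) : Prop :=
  norm_C1_rect T L (fun t x => A t x - Ae) <= delta /\
  norm_C1_rect T L (fun t x => V t x - Ve) <= delta.

(* Main.v *)
Require Import Defs.
From Stdlib Require Import Reals Lra Lia Classical ClassicalEpsilon List.
From Coquelicot Require Import Coquelicot.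
Import Defs.
Open Scope R_scope.

(** Write c(a) = sqrt (g a H'(a)) and let G be a primitive of c(a)/a.  For
    s = 1 and s = -1 the Riemann invariant R_s = V + s G(A) is transported
    exactly, without source term, at the speed l_s = V + s c(A), which near
    the equilibrium has the sign of s and satisfies |l_s| > L/T.  Two remarks
    make the observability argument short.

    First, the side x = 0 controls the side x = L.  Near a subcritical state
    the map (A,V) -> (S,Q) is bi-Lipschitz: its Jacobian matrix
    ((g H'(A), V), (V, A)) is symmetric and positive definite.  As S and Q at
    x = L are those at x = 0 minus the data h and hb, differences of states at
    x = L are controlled by differences at x = 0 and by h, hb
    ([riemann_at_sides]).

    Second, characteristics are parametrized by x, as solutions t(x) of
    t' = 1 / l_s.  Crossing the whole canal takes less than T, so the
    characteristic through any point of [0,T] x [0,L] meets one of the two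
    sides within [0,T] ([reach_side]); the one through (0,x) meets the side to
    which l_s points ([reach_side_from_start]).  Since R_s is constant on it,
    R_s - R_s(equilibrium) at t = 0 is bounded by its values on the sides.  The
    point of arrival depends on x in a Lipschitz way ([characteristic_close]),
    so a Lipschitz bound in t for R_s on the sides becomes a Lipschitz bound
    in x at t = 0 ([initial_riemann_lipschitz]).  For C^1 functions this is a
    bound of the derivative, and no equation for R_x is ever needed.

    For uniqueness, two solutions with the same observation and the same h, hb
    have equal invariants on both sides.  Along a characteristic of the first
    solution the invariant of the second one varies at a rate proportional to
    its own x-derivative times the difference of the speeds
    ([difference_along_characteristic]), that is O(delta) times the difference
    of the solutions.  Hence a bound F of this difference on the whole rectangle
    improves to F/2 when delta is small, and the difference vanishes.  Taking
    the equilibrium as second solution, the same inequality gives the sup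
    bound of the observability estimate.

    The derivatives in t and x of the coefficient 1 / l_s are O(delta) too, so
    the Picard iteration for the characteristics contracts on all of [0,L] when
    delta is small. *)

(** * Derivatives relative to a closed interval *)

(** Linear approximation form of the derivative: it avoids the quotient, and
    so composes without a case distinction on whether the increment is 0. *)
Lemma D_in_eps a b f l x :
  D_in f (fun _ => l) (Icc a b) x <->
  (forall eps, 0 < eps -> exists d, 0 < d /\
     forall y, Icc a b y -> Rabs (y - x) < d ->
       Rabs (f y - f x - l * (y - x)) <= eps * Rabs (y - x)).
Proof.
  split.
  - intros H eps he.
    destruct (H eps he) as [d [hd Hd]].
    exists d; split; [exact hd|].
    intros y hy hyx.
    destruct (Req_dec y x) as [->|hne].
    { replace (f x - f x - l * (x - x)) with 0 by ring.
      replace (x - x) with 0 by ring. rewrite Rabs_R0. lra. }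
    assert (h := Hd y (conj (conj hy (not_eq_sym hne)) hyx)).
    simpl in h. unfold Rdist in h.
    replace (f y - f x - l * (y - x))
      with (((f y - f x) / (y - x) - l) * (y - x)) by (field; lra).
    rewrite Rabs_mult. apply Rmult_le_compat_r; [apply Rabs_pos|lra].
  - intros H eps he.
    destruct (H (eps / 2)) as [d [hd Hd]]; [lra|].
    exists d; split; [exact hd|].
    intros y [[hy hne] hyx]. simpl in hyx |- *. unfold Rdist in *.
    assert (h := Hd y hy hyx).
    assert (hp : 0 < Rabs (y - x)) by (apply Rabs_pos_lt; lra).
    replace (f y - f x - l * (y - x))
      with (((f y - f x) / (y - x) - l) * (y - x)) in h by (field; lra).
    rewrite Rabs_mult in h. apply Rmult_le_reg_r in h; [lra|exact hp].
Qed.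

Lemma D_in_subset a b p q f l x :
  a <= p -> q <= b ->
  D_in f (fun _ => l) (Icc a b) x -> D_in f (fun _ => l) (Icc p q) x.
Proof.
  intros hp hq H eps he. destruct (H eps he) as [d [hd Hd]].
  exists d; split; [exact hd|].
  intros y [[[h1 h2] hne] hy]. apply Hd. repeat split; try assumption; lra.
Qed.

Lemma is_derive_D_in a b f l x :
  is_derive f x l -> D_in f (fun _ => l) (Icc a b) x.
Proof.
  intros H. apply is_derive_Reals in H. apply D_in_eps. intros eps he.
  destruct (H eps he) as [d Hd]. exists d; split; [apply cond_pos|].
  intros y _ hy.
  destruct (Req_dec y x) as [->|hne].
  { replace (f x - f x - l * (x - x)) with 0 by ring.
    replace (x - x) with 0 by ring. rewrite Rabs_R0. lra. }
  assert (h := Hd (y - x) ltac:(lra) hy).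
  replace (x + (y - x)) with y in h by ring.
  replace (f y - f x - l * (y - x))
    with (((f y - f x) / (y - x) - l) * (y - x)) by (field; lra).
  rewrite Rabs_mult. apply Rmult_le_compat_r; [apply Rabs_pos|lra].
Qed.

Lemma D_in_comp a b f l g m x :
  D_in f (fun _ => l) (Icc a b) x -> is_derive g (f x) m ->
  D_in (fun y => g (f y)) (fun _ => m * l) (Icc a b) x.
Proof.
  intros Hf Hg. apply is_derive_Reals in Hg.
  assert (Hg' : D_in g (fun _ => m) no_cond (f x))
    by (apply derivable_pt_lim_D_in; exact Hg).
  assert (h := Dcomp _ _ _ _ _ _ _ Hf Hg').
  intros eps he. destruct (h eps he) as [d [hd Hd]].
  exists d; split; [exact hd|].
  intros y [[hy hne] hyx]. rewrite (Rmult_comm m l). apply Hd.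
  repeat split; try assumption; apply hy.
Qed.

Lemma D_in_plus a b f l g m x :
  D_in f (fun _ => l) (Icc a b) x -> D_in g (fun _ => m) (Icc a b) x ->
  D_in (fun y => f y + g y) (fun _ => l + m) (Icc a b) x.
Proof. exact (Dadd _ (fun _ => l) (fun _ => m) f g x). Qed.

Lemma D_in_mult a b f l g m x :
  D_in f (fun _ => l) (Icc a b) x -> D_in g (fun _ => m) (Icc a b) x ->
  D_in (fun y => f y * g y) (fun _ => l * g x + f x * m) (Icc a b) x.
Proof. intros Hf Hg; exact (Dmult _ (fun _ => l) (fun _ => m) f g x Hf Hg). Qed.

Lemma D_in_const a b k x : D_in (fun _ => k) (fun _ => 0) (Icc a b) x.
Proof. apply is_derive_D_in. auto_derive; [exact I|reflexivity]. Qed.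

Lemma Icc_near a b x d : a < b -> Icc a b x -> 0 < d ->
  exists y, Icc a b y /\ y <> x /\ Rabs (y - x) < d.
Proof.
  intros hab [h1 h2] hd.
  destruct (Rlt_dec x b) as [h|h].
  - exists (x + Rmin (b - x) (d / 2)).
    assert (h3 := Rmin_l (b - x) (d / 2)). assert (h4 := Rmin_r (b - x) (d / 2)).
    assert (0 < Rmin (b - x) (d / 2)) by (apply Rmin_glb_lt; lra).
    repeat split; try lra. rewrite Rabs_pos_eq; lra.
  - exists (x - Rmin (x - a) (d / 2)).
    assert (h3 := Rmin_l (x - a) (d / 2)). assert (h4 := Rmin_r (x - a) (d / 2)).
    assert (0 < Rmin (x - a) (d / 2)) by (apply Rmin_glb_lt; lra).
    repeat split; try lra. rewrite Rabs_left; lra.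
Qed.

(** Converse of [D_in_bound_lipschitz] at one point.  Through this pair of
    lemmas every C^1 estimate below is proved as a sup bound plus a Lipschitz
    bound. *)
Lemma D_in_lipschitz_bound a b f l x M : a < b -> Icc a b x ->
  D_in f (fun _ => l) (Icc a b) x ->
  (forall y, Icc a b y -> Rabs (f y - f x) <= M * Rabs (y - x)) ->
  Rabs l <= M.
Proof.
  intros hab hx H HM. apply Rnot_lt_le. intro hlt.
  assert (he : 0 < (Rabs l - M) / 2) by lra.
  rewrite D_in_eps in H.
  destruct (H _ he) as [d [hd Hd]].
  destruct (Icc_near a b x d hab hx hd) as [y [hy [hne hyx]]].
  assert (h1 := Hd y hy hyx). assert (h2 := HM y hy).
  assert (hp : 0 < Rabs (y - x)) by (apply Rabs_pos_lt; lra).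
  assert (h3 : Rabs l * Rabs (y - x)
    <= Rabs (f y - f x) + Rabs (f y - f x - l * (y - x))).
  { rewrite <- Rabs_mult.
    replace (l * (y - x)) with ((f y - f x) - (f y - f x - l * (y - x))) at 1 by ring.
    eapply Rle_trans; [apply Rabs_triang|]. rewrite Rabs_Ropp. lra. }
  nra.
Qed.

Lemma D_in_unique a b f l m x : a < b -> Icc a b x ->
  D_in f (fun _ => l) (Icc a b) x -> D_in f (fun _ => m) (Icc a b) x -> l = m.
Proof.
  intros hab hx Hl Hm.
  assert (h : D_in (fun y => f y + -1 * f y) (fun _ => l + (0 * f x + -1 * m)) (Icc a b) x).
  { apply D_in_plus; [exact Hl|].
    apply (D_in_mult a b (fun _ => -1) 0 f m x); [apply D_in_const|exact Hm]. }
  assert (h0 := D_in_lipschitz_bound _ _ _ _ _ 0 hab hx h).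
  assert (h1 : Rabs (l + (0 * f x + -1 * m)) <= 0).
  { apply h0. intros y _. replace (f y + -1 * f y - (f x + -1 * f x)) with 0 by ring.
    rewrite Rabs_R0. lra. }
  assert (h2 := Rle_abs (l + (0 * f x + -1 * m))).
  assert (h3 := Rle_abs (- (l + (0 * f x + -1 * m)))). rewrite Rabs_Ropp in h3. lra.
Qed.

Lemma Derive_on_correct a b f x : a < b -> Icc a b x -> ex_derive_on a b f x ->
  D_in f (fun _ => Derive_on a b f x) (Icc a b) x.
Proof.
  intros hab hx [l Hl].
  apply (iota_correct (fun l => D_in f (fun _ => l) (Icc a b) x)).
  exists l; split; [exact Hl|]. intros m Hm.
  exact (D_in_unique a b f l m x hab hx Hl Hm).
Qed.

Lemma Derive_on_unique a b f l x : a < b -> Icc a b x ->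
  D_in f (fun _ => l) (Icc a b) x -> Derive_on a b f x = l.
Proof.
  intros hab hx H. apply (D_in_unique a b f _ _ x hab hx); [|exact H].
  apply Derive_on_correct; [exact hab|exact hx|]. exists l; exact H.
Qed.

(** Projection onto [a,b]: precomposing with it extends functions beyond an
    interval or a rectangle without losing continuity or Lipschitz constants. *)
Definition clamp a b x := Rmax a (Rmin b x).

Lemma clamp_Icc a b x : a <= b -> Icc a b (clamp a b x).
Proof.
  intros h. unfold clamp, Icc. split; [apply Rmax_l|].
  apply Rmax_lub; [exact h|apply Rmin_l].
Qed.

Lemma clamp_id a b x : Icc a b x -> clamp a b x = x.
Proof.
  intros [h1 h2]. unfold clamp.
  rewrite Rmin_right by lra. apply Rmax_right; lra.
Qed.

Lemma clamp_lipschitz a b x y : Rabs (clamp a b x - clamp a b y) <= Rabs (x - y).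
Proof.
  unfold clamp, Rmax, Rmin.
  repeat (destruct (Rle_dec _ _)); unfold Rabs; repeat (destruct (Rcase_abs _)); lra.
Qed.

Lemma lipschitz_continuous f K x :
  (forall y, Rabs (f y - f x) <= K * Rabs (y - x)) -> continuous f x.
Proof.
  intros H. apply continuity_pt_filterlim. intros eps he.
  exists (eps / (Rabs K + 1)). assert (hK := Rabs_pos K).
  split; [apply Rdiv_lt_0_compat; lra|].
  intros y [_ hy]. simpl in *. unfold Rdist in *.
  apply Rle_lt_trans with (1 := H y).
  apply Rle_lt_trans with ((Rabs K + 1) * Rabs (y - x)).
  - apply Rmult_le_compat_r; [apply Rabs_pos|]. assert (h := Rle_abs K); lra.
  - apply Rlt_le_trans with ((Rabs K + 1) * (eps / (Rabs K + 1))).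
    + apply Rmult_lt_compat_l; lra.
    + right; field; lra.
Qed.

(** The usual mean value theorem for f composed with [clamp a b], which is
    two-sidedly continuous at the end points. *)
Lemma D_in_MVT a b f l : a < b ->
  (forall x, Icc a b x -> D_in f (fun _ => l x) (Icc a b) x) ->
  exists c, Icc a b c /\ f b - f a = l c * (b - a).
Proof.
  intros hab H.
  destruct (MVT_gen (fun x => f (clamp a b x)) a b l) as [c [hc E]].
  - rewrite Rmin_left, Rmax_right by lra. intros x hx.
    apply is_derive_Reals. intros eps he.
    assert (h := H x ltac:(split; lra)). rewrite D_in_eps in h.
    destruct (h (eps / 2) ltac:(lra)) as [d [hd Hd]].
    assert (hd' : 0 < Rmin d (Rmin (x - a) (b - x))) by (repeat apply Rmin_glb_lt; lra).
    exists (mkposreal _ hd'). intros k hk hkd. simpl in hkd.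
    assert (h1 := Rmin_l d (Rmin (x - a) (b - x))).
    assert (h2 := Rmin_r d (Rmin (x - a) (b - x))).
    assert (h3 := Rmin_l (x - a) (b - x)). assert (h4 := Rmin_r (x - a) (b - x)).
    assert (h5 : Rabs k < x - a) by lra. assert (h6 : Rabs k < b - x) by lra.
    apply Rabs_def2 in h5. apply Rabs_def2 in h6.
    rewrite !clamp_id by (split; lra).
    assert (h7 := Hd (x + k) ltac:(split; lra)).
    replace (x + k - x) with k in h7 by ring.
    assert (h8 := h7 ltac:(lra)).
    assert (hp : 0 < Rabs k) by (apply Rabs_pos_lt; exact hk).
    replace ((f (x + k) - f x) / k - l x)
      with ((f (x + k) - f x - l x * k) / k) by (field; exact hk).
    unfold Rdiv. rewrite Rabs_mult, Rabs_inv.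
    apply Rle_lt_trans with (eps / 2 * Rabs k * / Rabs k).
    + apply Rmult_le_compat_r; [|exact h8].
      left; apply Rinv_0_lt_compat; exact hp.
    + rewrite Rmult_assoc, Rinv_r by lra. lra.
  - rewrite Rmin_left, Rmax_right by lra. intros x hx.
    assert (h := H x hx). rewrite D_in_eps in h.
    intros eps he.
    destruct (h 1 ltac:(lra)) as [d [hd Hd]].
    assert (hl := Rabs_pos (l x)).
    exists (Rmin d (eps / (Rabs (l x) + 2))).
    split; [apply Rmin_glb_lt; [lra|apply Rdiv_lt_0_compat; lra]|].
    intros y [_ hy]. simpl in *. unfold Rdist in *.
    assert (h1 := Rmin_l d (eps / (Rabs (l x) + 2))).
    assert (h2 := Rmin_r d (eps / (Rabs (l x) + 2))).
    assert (h3 := clamp_lipschitz a b y x).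
    assert (hy' := clamp_Icc a b y ltac:(lra)).
    rewrite (clamp_id a b x) in * by exact hx.
    set (z := clamp a b y) in *.
    assert (h4 := Hd z hy' ltac:(lra)).
    replace (f z - f x) with (f z - f x - l x * (z - x) + l x * (z - x)) by ring.
    apply Rle_lt_trans with (1 := Rabs_triang _ _). rewrite Rabs_mult.
    apply Rle_lt_trans with ((Rabs (l x) + 1) * Rabs (y - x)).
    + assert (h5 : Rabs (l x) * Rabs (z - x) <= Rabs (l x) * Rabs (y - x))
        by (apply Rmult_le_compat_l; lra). lra.
    + apply Rle_lt_trans with ((Rabs (l x) + 1) * (eps / (Rabs (l x) + 2))).
      * apply Rmult_le_compat_l; lra.
      * apply Rlt_le_trans with ((Rabs (l x) + 2) * (eps / (Rabs (l x) + 2))).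
        { apply Rmult_lt_compat_r; [apply Rdiv_lt_0_compat|]; lra. }
        right; field; lra.
  - rewrite Rmin_left, Rmax_right in hc by lra.
    exists c; split; [exact hc|].
    rewrite !clamp_id in E by (split; lra). exact E.
Qed.

Lemma D_in_MVT_sub a b f l x y :
  (forall z, Icc a b z -> D_in f (fun _ => l z) (Icc a b) z) ->
  Icc a b x -> Icc a b y ->
  exists c, Icc (Rmin x y) (Rmax x y) c /\ Icc a b c /\ f y - f x = l c * (y - x).
Proof.
  intros H hx hy.
  assert (K : forall p q, Icc a b p -> Icc a b q -> p < q ->
    exists c, Icc p q c /\ f q - f p = l c * (q - p)).
  { intros p q [hp1 hp2] [hq1 hq2] hpq. apply D_in_MVT; [exact hpq|].
    intros z [hz1 hz2]. apply (D_in_subset a b); [lra|lra|]. apply H; split; lra. }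
  destruct hx as [hx1 hx2], hy as [hy1 hy2].
  destruct (Rtotal_order x y) as [h|[h|h]].
  - destruct (K x y) as [c [[hc1 hc2] E]]; try (split; assumption); [exact h|].
    exists c. rewrite Rmin_left, Rmax_right by lra. repeat split; lra.
  - subst y. exists x. rewrite Rmin_left, Rmax_right by lra. repeat split; lra.
  - destruct (K y x) as [c [[hc1 hc2] E]]; try (split; assumption); [exact h|].
    exists c. rewrite Rmin_right, Rmax_left by lra. repeat split; lra.
Qed.

Lemma D_in_bound_lipschitz a b f l M x y :
  (forall z, Icc a b z -> D_in f (fun _ => l z) (Icc a b) z) ->
  (forall z, Icc a b z -> Rabs (l z) <= M) ->
  Icc a b x -> Icc a b y -> Rabs (f y - f x) <= M * Rabs (y - x).
Proof.
  intros H HM hx hy. destruct (D_in_MVT_sub a b f l x y H hx hy) as [c [_ [hc E]]].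
  rewrite E, Rabs_mult. apply Rmult_le_compat_r; [apply Rabs_pos|auto].
Qed.

(** * Sup norms and C^1 norms *)

Lemma sup_norm_le {X} (D : X -> Prop) f M x0 :
  D x0 -> (forall x, D x -> Rabs (f x) <= M) -> sup_norm D f <= M.
Proof.
  intros h0 H. unfold sup_norm.
  set (E := fun r => exists x, D x /\ r = Rabs (f x)).
  destruct (Lub_Rbar_correct E) as [hub hl].
  assert (h1 : Rbar_le (Lub_Rbar E) M).
  { apply hl. intros r [x [hx ->]]. apply H; exact hx. }
  assert (h2 := hub (Rabs (f x0)) (ex_intro _ x0 (conj h0 eq_refl))).
  destruct (Lub_Rbar E); simpl in *; [exact h1|destruct h1|destruct h2].
Qed.

(** Boundedness has to be known beforehand, because [real] sends an infinite
    supremum to 0. *)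
Lemma le_sup_norm {X} (D : X -> Prop) f x :
  (exists M, forall x, D x -> Rabs (f x) <= M) -> D x ->
  Rabs (f x) <= sup_norm D f.
Proof.
  intros [M H] hx. unfold sup_norm.
  set (E := fun r => exists x, D x /\ r = Rabs (f x)).
  destruct (Lub_Rbar_correct E) as [hub hl].
  assert (h1 : Rbar_le (Lub_Rbar E) M).
  { apply hl. intros r [y [hy ->]]. apply H; exact hy. }
  assert (h2 := hub (Rabs (f x)) (ex_intro _ x (conj hx eq_refl))).
  destruct (Lub_Rbar E); simpl in *; [exact h2|destruct h1|destruct h2].
Qed.

(** By compactness: finitely many neighbourhoods, each carrying a bound of f,
    cover the rectangle. *)
Lemma continuous_on_rect_bounded T L (f : R * R -> R) :
  continuous_on (rect T L) f ->
  exists M, forall p, rect T L p -> Rabs (f p) <= M.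
Proof.
  intros H.
  assert (loc : forall p : R * R, exists d : posreal,
    rect T L p -> forall q, rect T L q -> ball p d q -> Rabs (f q) <= Rabs (f p) + 1).
  { intros p. destruct (classic (rect T L p)) as [hp|hp].
    - assert (h := proj1 (filterlim_locally _ _) (H p hp) (mkposreal 1 Rlt_0_1)).
      destruct h as [d hd]. exists d. intros _ q hq hpq.
      assert (h := hd q hpq hq).
      change (Rabs (f q - f p) < 1) in h.
      replace (f q) with (f q - f p + f p) by ring.
      apply Rle_trans with (1 := Rabs_triang _ _); lra.
    - exists (mkposreal 1 Rlt_0_1). intros h; contradiction. }
  set (delta := fun p => proj1_sig (constructive_indefinite_description _ (loc p))).
  assert (hdelta : forall p, rect T L p -> forall q, rect T L q ->
    ball p (delta p) q -> Rabs (f q) <= Rabs (f p) + 1)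
    by (intros p; exact (proj2_sig (constructive_indefinite_description _ (loc p)))).
  apply NNPP. intro hno.
  apply (compactness_list 2 (0, (0, tt)) (T, (L, tt))
    (fun u => delta (fst u, fst (snd u)))).
  intros [l hl]. apply hno. clear hno.
  exists (fold_right (fun u m => Rmax (Rabs (f (fst u, fst (snd u))) + 1) m) 0 l).
  intros [t x] [[ht1 ht2] [hx1 hx2]]. simpl in ht1, ht2, hx1, hx2.
  destruct (hl (t, (x, tt))) as [[t' [x' []]] [hin [hb hc]]].
  { simpl. repeat split; lra. }
  simpl in hb, hc.
  apply Rle_trans with (Rabs (f (t', x')) + 1).
  - apply hdelta; [split; simpl; split; tauto|split; simpl; split; lra|].
    split; simpl; [apply hc|apply hc].
  - clear - hin. induction l as [|u l IH]; [destruct hin|].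
    destruct hin as [->|hin]; simpl; [apply Rmax_l|].
    apply Rle_trans with (2 := Rmax_r _ _). apply IH; exact hin.
Qed.

Lemma continuous_on_Icc_bounded b (f : R -> R) :
  continuous_on (Icc 0 b) f ->
  exists M, forall x, Icc 0 b x -> Rabs (f x) <= M.
Proof.
  intros H.
  destruct (continuous_on_rect_bounded 0 b (fun p => f (snd p))) as [M HM].
  - intros [t x] [_ hx] P hP. simpl in hx, hP.
    destruct (H x hx P hP) as [d hd]. exists d.
    intros [t' x'] [_ hxx] [_ hx']. apply hd; [exact hxx|exact hx'].
  - exists M. intros x hx. apply (HM (0, x)). split; [split; simpl; lra|exact hx].
Qed.

Lemma C1_sup b f : 0 < b -> C1 0 b f ->
  forall x y, Icc 0 b x -> Icc 0 b y ->
    Rabs (f x) <= norm_C1 0 b f /\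
    Rabs (f x - f y) <= norm_C1 0 b f * Rabs (x - y).
Proof.
  intros hb [Hd [Hc Hc']] x y hx hy. unfold norm_C1. split.
  - apply Rle_trans with (2 := Rmax_l _ _).
    apply le_sup_norm; [apply continuous_on_Icc_bounded; exact Hc|exact hx].
  - apply (D_in_bound_lipschitz 0 b f (Derive_on 0 b f)); [| |exact hy|exact hx].
    + intros z hz. apply Derive_on_correct; auto.
    + intros z hz. apply Rle_trans with (2 := Rmax_r _ _).
      apply le_sup_norm; [apply continuous_on_Icc_bounded; exact Hc'|exact hz].
Qed.

Lemma norm_C1_le b f M : 0 < b -> C1 0 b f ->
  (forall x, Icc 0 b x -> Rabs (f x) <= M) ->
  (forall x y, Icc 0 b x -> Icc 0 b y -> Rabs (f y - f x) <= M * Rabs (y - x)) ->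
  norm_C1 0 b f <= M.
Proof.
  intros hb [Hd _] H0 H1.
  assert (h0 : Icc 0 b 0) by (split; lra).
  apply Rmax_lub.
  - exact (sup_norm_le _ _ _ 0 h0 H0).
  - apply (sup_norm_le _ _ _ 0 h0). intros x hx.
    apply (D_in_lipschitz_bound 0 b f _ x M hb hx); [|auto].
    apply Derive_on_correct; auto.
Qed.

Lemma ex_derive_on_shift a b f k x : a < b -> Icc a b x -> ex_derive_on a b f x ->
  ex_derive_on a b (fun y => f y - k) x /\
  Derive_on a b (fun y => f y - k) x = Derive_on a b f x.
Proof.
  intros hab hx [l Hl].
  assert (h : D_in (fun y => f y - k) (fun _ => l) (Icc a b) x).
  { rewrite <- (Rplus_0_r l). apply (D_in_plus a b f l (fun _ => - k) 0 x Hl).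
    apply D_in_const. }
  split; [exists l; exact h|].
  rewrite (Derive_on_unique a b f l x hab hx Hl).
  apply Derive_on_unique; assumption.
Qed.

Lemma continuous_on_shift {U : UniformSpace} (D : U -> Prop) (f : U -> R) k :
  continuous_on D f -> continuous_on D (fun x => f x - k).
Proof.
  intros H x hx.
  apply (filterlim_comp _ _ _ f (fun y => y - k) _ _ _ (H x hx)).
  apply (continuous_minus (fun y : R => y) (fun _ => k));
    [apply continuous_id|apply continuous_const].
Qed.

Lemma continuous_on_eq {U : UniformSpace} (D : U -> Prop) (f f' : U -> R) :
  (forall x, D x -> f x = f' x) -> continuous_on D f -> continuous_on D f'.
Proof.
  intros E H x hx. rewrite <- (E x hx).
  apply (filterlim_within_ext D f f' E). exact (H x hx).
Qed.

Lemma C1_shift b f k : 0 < b -> C1 0 b f -> C1 0 b (fun x => f x - k).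
Proof.
  intros hb [Hd [Hc Hc']]. split; [|split].
  - intros x hx. apply ex_derive_on_shift; auto.
  - apply continuous_on_shift; exact Hc.
  - apply continuous_on_eq with (2 := Hc'). intros x hx. symmetry.
    apply ex_derive_on_shift; auto.
Qed.

Lemma C1_rect_side T L u k x : 0 < T -> Icc 0 L x -> C1_rect T L u ->
  C1 0 T (fun t => u t x - k).
Proof.
  intros hT hx [Hd [Hc [Hct _]]].
  apply (C1_shift T (fun t => u t x)); [exact hT|].
  assert (slice : forall f : R * R -> R, continuous_on (rect T L) f ->
    continuous_on (Icc 0 T) (fun t => f (t, x))).
  { intros f H t ht P hP.
    destruct (H (t, x) (conj ht hx) P hP) as [d hd]. exists d.
    intros t' ht' hI. apply hd; [|split; [exact hI|exact hx]].
    split; [exact ht'|apply ball_center]. }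
  split; [|split].
  - intros t ht. apply (Hd t x). split; assumption.
  - exact (slice _ Hc).
  - exact (slice _ Hct).
Qed.

Lemma C1_rect_close T L u k d : 0 < T -> 0 < L -> C1_rect T L u ->
  norm_C1_rect T L (fun t x => u t x - k) <= d ->
  forall t x, rect T L (t, x) ->
    Rabs (u t x - k) <= d /\ Rabs (Dt T u t x) <= d /\ Rabs (Dx L u t x) <= d.
Proof.
  intros hT hL [Hd [Hc [Hct Hcx]]] Hn t x hp.
  assert (Et : forall p, rect T L p -> Dt T u (fst p) (snd p) =
    Dt T (fun t x => u t x - k) (fst p) (snd p)).
  { intros [s y] [hs hy]. simpl in *. symmetry.
    apply (ex_derive_on_shift 0 T (fun t => u t y)); [exact hT|exact hs|].
    apply Hd; split; assumption. }
  assert (Ex : forall p, rect T L p -> Dx L u (fst p) (snd p) =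
    Dx L (fun t x => u t x - k) (fst p) (snd p)).
  { intros [s y] [hs hy]. simpl in *. symmetry.
    apply (ex_derive_on_shift 0 L (fun y => u s y)); [exact hL|exact hy|].
    apply Hd; split; assumption. }
  assert (Ht' := Et _ hp). assert (Hx' := Ex _ hp). simpl in Ht', Hx'.
  rewrite Ht', Hx'.
  assert (key : forall f : R * R -> R, continuous_on (rect T L) f ->
    sup_norm (rect T L) f <= d -> Rabs (f (t, x)) <= d).
  { intros f Hf hs. apply Rle_trans with (2 := hs).
    apply le_sup_norm; [apply continuous_on_rect_bounded; exact Hf|exact hp]. }
  unfold norm_C1_rect in Hn.
  assert (h1 := Rle_trans _ _ _ (Rmax_l _ _) Hn).
  assert (h2 := Rle_trans _ _ _ (Rmax_r _ _) Hn).
  assert (h3 := Rle_trans _ _ _ (Rmax_l _ _) h2).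
  assert (h4 := Rle_trans _ _ _ (Rmax_r _ _) h2).
  split; [|split].
  - apply (key (fun p => u (fst p) (snd p) - k)); [|exact h1].
    apply (continuous_on_shift (rect T L) (fun p => u (fst p) (snd p))). exact Hc.
  - apply (key (fun p => Dt T (fun t x => u t x - k) (fst p) (snd p))); [|exact h3].
    exact (continuous_on_eq _ _ _ Et Hct).
  - apply (key (fun p => Dx L (fun t x => u t x - k) (fst p) (snd p))); [|exact h4].
    exact (continuous_on_eq _ _ _ Ex Hcx).
Qed.

(** * Characteristic curves *)

Lemma is_lim_seq_half_pow c : is_lim_seq (fun n => c * (/ 2) ^ n) 0.
Proof.
  replace 0 with (c * 0) by ring.
  apply (is_lim_seq_scal_l (fun n => (/ 2) ^ n) c 0).
  apply is_lim_seq_geom. rewrite Rabs_pos_eq; lra.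
Qed.

Lemma le_half_pow_eq0 a c : (forall n, Rabs a <= c * (/ 2) ^ n) -> a = 0.
Proof.
  intros H.
  assert (h : Rbar_le (Rabs a) 0)
    by (exact (is_lim_seq_le _ _ _ _ H (is_lim_seq_const _) (is_lim_seq_half_pow c))).
  simpl in h. assert (h1 := Rabs_pos a).
  destruct (Req_dec a 0) as [e|e]; [exact e|].
  assert (h2 := Rabs_pos_lt a e). lra.
Qed.

Lemma ex_RInt_of_continuous (f : R -> R) a b :
  (forall s, continuous f s) -> ex_RInt f a b.
Proof. intros H. apply (@ex_RInt_continuous R_CompleteNormedModule). auto. Qed.

Lemma abs_RInt_le (f : R -> R) M a b :
  (forall s, continuous f s) -> (forall s, Rabs (f s) <= M) ->
  Rabs (RInt f a b) <= M * Rabs (b - a).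
Proof.
  intros Hc HM.
  assert (K : forall p q, p <= q -> Rabs (RInt f p q) <= (q - p) * M).
  { intros p q hpq. apply abs_RInt_le_const; [exact hpq| |auto].
    apply ex_RInt_of_continuous; auto. }
  destruct (Rle_dec a b) as [h|h].
  - rewrite (Rabs_pos_eq (b - a)) by lra. rewrite Rmult_comm. auto.
  - rewrite <- (opp_RInt_swap f).
    + change (Rabs (- RInt f b a) <= M * Rabs (b - a)). rewrite Rabs_Ropp.
      rewrite (Rabs_left (b - a)) by lra.
      replace (M * - (b - a)) with ((a - b) * M) by ring. apply K; lra.
    + apply ex_RInt_of_continuous; auto.
Qed.

Lemma RInt_sub_continuous (f g : R -> R) a b :
  (forall s, continuous f s) -> (forall s, continuous g s) ->
  RInt f a b - RInt g a b = RInt (fun s => f s - g s) a b.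
Proof.
  intros Hf Hg. symmetry.
  apply (RInt_minus f g a b); apply ex_RInt_of_continuous; auto.
Qed.

Lemma RInt_diff_continuous (f : R -> R) a b c :
  (forall s, continuous f s) -> RInt f a c - RInt f a b = RInt f b c.
Proof.
  intros Hf.
  assert (h : RInt f a b + RInt f b c = RInt f a c)
    by (apply (RInt_Chasles f a b c); apply ex_RInt_of_continuous; auto).
  lra.
Qed.

Lemma sub_shift t a b : t + a - (t + b) = a - b.
Proof. ring. Qed.

(** Picard iterates for t' = mu(t,x), t(x0) = t0.  Clamping the upper bound of
    integration keeps every iterate defined, and the successive differences
    bounded, on the whole line, while nothing changes on [0,L]. *)
Fixpoint picard (mu : R -> R -> R) (L t0 x0 : R) (n : nat) (x : R) : R :=
  match n with
  | O => t0
  | S n => t0 + RInt (fun s => mu (picard mu L t0 x0 n s) s) x0 (clamp 0 L x)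
  end.

(** With K L <= 1/2 one Picard step halves the sup distance over [0,L], so the
    iterates converge geometrically and the limit is defined on all of [0,L].
    The solution is finally taken as the integral of mu along the limit:
    unlike the clamped limit, it has a two-sided derivative at 0 and L. *)
Lemma characteristic_exists (mu : R -> R -> R) (K m L t0 x0 : R) :
  Icc 0 L x0 -> 0 <= K -> K * L <= / 2 ->
  (forall t x t' x', Rabs (mu t x - mu t' x') <= K * (Rabs (t - t') + Rabs (x - x'))) ->
  (forall t x, Rabs (mu t x) <= m) ->
  exists tau, tau x0 = t0 /\
    forall x, Icc 0 L x -> is_derive tau x (mu (tau x) x).
Proof.
  intros hx0 hK hKL Hlip Hm.
  assert (hL : 0 <= L) by (destruct hx0; lra).
  assert (hm : 0 <= m) by (apply Rle_trans with (2 := Hm 0 0); apply Rabs_pos).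
  assert (along : forall X, (forall x y, Rabs (X y - X x) <= m * Rabs (y - x)) ->
    forall s, continuous (fun s => mu (X s) s) s).
  { intros X HX s. apply lipschitz_continuous with (K * (m + 1)). intros y.
    apply Rle_trans with (1 := Hlip _ _ _ _).
    rewrite Rmult_assoc. apply Rmult_le_compat_l; [exact hK|].
    assert (h := HX s y). lra. }
  assert (diff : forall X Y B, 0 <= B ->
    (forall x y, Rabs (X y - X x) <= m * Rabs (y - x)) ->
    (forall x y, Rabs (Y y - Y x) <= m * Rabs (y - x)) ->
    (forall x, Rabs (X x - Y x) <= B) -> forall x, Icc 0 L x ->
    Rabs (RInt (fun s => mu (X s) s) x0 x - RInt (fun s => mu (Y s) s) x0 x) <= / 2 * B).
  { intros X Y B hB HX HY HXY x [hx1 hx2]. destruct hx0 as [h01 h02].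
    rewrite RInt_sub_continuous by (apply along; assumption).
    apply Rle_trans with (K * B * Rabs (x - x0)).
    - apply abs_RInt_le.
      + intros s. apply (continuous_minus (fun s => mu (X s) s)); apply along; assumption.
      + intros s. apply Rle_trans with (1 := Hlip _ _ _ _).
        replace (s - s) with 0 by ring. rewrite Rabs_R0, Rplus_0_r.
        apply Rmult_le_compat_l; auto.
    - assert (h1 : Rabs (x - x0) <= L) by (apply Rabs_le; lra).
      assert (h2 : K * B * Rabs (x - x0) <= K * B * L)
        by (apply Rmult_le_compat_l; [apply Rmult_le_pos; assumption|exact h1]).
      assert (h3 : K * L * B <= / 2 * B) by (apply Rmult_le_compat_r; assumption).
      lra. }
  set (X := picard mu L t0 x0).
  assert (XL : forall n x y, Rabs (X n y - X n x) <= m * Rabs (y - x)).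
  { induction n as [|n IH]; intros x y.
    - change (Rabs (t0 - t0) <= m * Rabs (y - x)).
      replace (t0 - t0) with 0 by ring. rewrite Rabs_R0.
      apply Rmult_le_pos; [exact hm|apply Rabs_pos].
    - set (f := fun s => mu (picard mu L t0 x0 n s) s).
      assert (hc : forall s, continuous f s) by (apply along; exact IH).
      change (Rabs (t0 + RInt f x0 (clamp 0 L y) - (t0 + RInt f x0 (clamp 0 L x)))
        <= m * Rabs (y - x)).
      rewrite sub_shift, RInt_diff_continuous by exact hc.
      apply Rle_trans with (m * Rabs (clamp 0 L y - clamp 0 L x)).
      + apply abs_RInt_le; [exact hc|]. intros s; apply Hm.
      + apply Rmult_le_compat_l; [exact hm|apply clamp_lipschitz]. }
  (* m L bounds the first increment: |mu| <= m, over a length at most L. *)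
  set (c := m * L).
  assert (hc0 : 0 <= c) by (apply Rmult_le_pos; assumption).
  assert (step : forall n x, Rabs (X (S n) x - X n x) <= c * (/ 2) ^ n).
  { induction n as [|n IH]; intros x.
    - change (Rabs (t0 + RInt (fun s => mu t0 s) x0 (clamp 0 L x) - t0) <= c * 1).
      rewrite Rplus_minus_l, Rmult_1_r. apply Rle_trans with (m * Rabs (clamp 0 L x - x0)).
      + apply abs_RInt_le; [|intros s; apply Hm].
        exact (along _ (XL O)).
      + apply Rmult_le_compat_l; [exact hm|].
        assert (h := clamp_Icc 0 L x hL). destruct h, hx0.
        apply Rabs_le; lra.
    - change (Rabs ((t0 + RInt (fun s => mu (X (S n) s) s) x0 (clamp 0 L x))
        - (t0 + RInt (fun s => mu (X n s) s) x0 (clamp 0 L x))) <= c * (/ 2) ^ S n).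
      rewrite sub_shift.
      apply Rle_trans with (/ 2 * (c * (/ 2) ^ n)).
      + apply diff; [|exact (XL _)|exact (XL _)|exact IH|apply clamp_Icc; exact hL].
        apply Rmult_le_pos; [exact hc0|apply pow_le; lra].
      + simpl. right; ring. }
  assert (tail : forall n k x, Rabs (X (k + n)%nat x - X n x) <= 2 * c * (/ 2) ^ n).
  { intros n k x.
    assert (h : Rabs (X (k + n)%nat x - X n x) <= 2 * c * (/ 2) ^ n - 2 * c * (/ 2) ^ (k + n)).
    { induction k as [|k IH].
      - simpl. replace (X n x - X n x) with 0 by ring. rewrite Rabs_R0. lra.
      - replace (X (S k + n)%nat x - X n x)
          with ((X (S (k + n)) x - X (k + n)%nat x) + (X (k + n)%nat x - X n x))
          by (simpl; ring).
        apply Rle_trans with (1 := Rabs_triang _ _).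
        assert (h := step (k + n)%nat x).
        replace ((/ 2) ^ (S k + n)) with (/ 2 * (/ 2) ^ (k + n)) by reflexivity.
        lra. }
    assert (h' : 0 <= 2 * c * (/ 2) ^ (k + n))
      by (apply Rmult_le_pos; [lra|apply pow_le; lra]).
    lra. }
  set (Z := fun x => real (Lim_seq (fun n => X n x))).
  assert (XZ : forall x, is_lim_seq (fun n => X n x) (Z x)).
  { intros x. apply Lim_seq_correct'. apply ex_lim_seq_cauchy_corr.
    intros eps. assert (h := is_lim_seq_half_pow (4 * c)).
    apply is_lim_seq_spec in h. destruct (h eps) as [N HN].
    exists N. assert (hN := HN N (le_n N)).
    assert (T : forall n, (N <= n)%nat -> Rabs (X n x - X N x) <= 2 * c * (/ 2) ^ N).
    { intros n hn. replace n with ((n - N) + N)%nat by lia. apply tail. }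
    intros n p hn hp.
    replace (X n x - X p x) with ((X n x - X N x) + - (X p x - X N x)) by ring.
    apply Rle_lt_trans with (1 := Rabs_triang _ _). rewrite Rabs_Ropp.
    assert (h1 := T n hn). assert (h2 := T p hp).
    rewrite Rminus_0_r in hN. assert (h3 := Rle_abs (4 * c * (/ 2) ^ N)). lra. }
  assert (ZX : forall n x, Rabs (X n x - Z x) <= 2 * c * (/ 2) ^ n).
  { intros n x. rewrite Rabs_minus_sym.
    assert (h : is_lim_seq (fun k => Rabs (X (k + n)%nat x - X n x)) (Rabs (Z x - X n x))).
    { apply (is_lim_seq_abs _ (Z x - X n x)).
      apply (is_lim_seq_minus' (fun k => X (k + n)%nat x) (fun _ => X n x)).
      - apply (is_lim_seq_incr_n (fun k => X k x)); apply XZ.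
      - apply is_lim_seq_const. }
    exact (is_lim_seq_le _ (fun _ => 2 * c * (/ 2) ^ n) _ _ (fun k => tail n k x) h
      (is_lim_seq_const _)). }
  assert (ZL : forall x y, Rabs (Z y - Z x) <= m * Rabs (y - x)).
  { intros x y.
    assert (h : is_lim_seq (fun k => Rabs (X k y - X k x)) (Rabs (Z y - Z x))).
    { apply (is_lim_seq_abs _ (Z y - Z x)).
      apply (is_lim_seq_minus' (fun k => X k y) (fun k => X k x)); apply XZ. }
    exact (is_lim_seq_le _ (fun _ => m * Rabs (y - x)) _ _ (fun k => XL k x y) h
      (is_lim_seq_const _)). }
  set (tau := fun x => t0 + RInt (fun s => mu (Z s) s) x0 x).
  assert (fixed : forall x, Icc 0 L x -> tau x = Z x).
  { intros x hx. apply Rminus_diag_uniq. apply le_half_pow_eq0 with (2 * c).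
    intros n.
    replace (tau x - Z x) with ((X (S n) x - Z x) + (tau x - X (S n) x)) by ring.
    apply Rle_trans with (1 := Rabs_triang _ _).
    assert (h1 := ZX (S n) x).
    assert (h2 : Rabs (tau x - X (S n) x) <= / 2 * (2 * c * (/ 2) ^ n)).
    { unfold tau. change (X (S n) x) with
        (t0 + RInt (fun s => mu (X n s) s) x0 (clamp 0 L x)).
      rewrite clamp_id by exact hx.
      rewrite sub_shift.
      apply diff; [|exact ZL|exact (XL n)| |exact hx].
      - apply Rmult_le_pos; [lra|apply pow_le; lra].
      - intros y. rewrite Rabs_minus_sym. apply ZX. }
    simpl in h1. lra. }
  exists tau. split.
  - unfold tau. rewrite RInt_point. change (t0 + 0 = t0). ring.
  - intros x hx. rewrite fixed by exact hx.
    rewrite <- (Rplus_0_l (mu (Z x) x)).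
    apply (is_derive_plus (fun _ => t0)); [apply @is_derive_const|].
    apply (is_derive_RInt (fun s => mu (Z s) s) _ x0).
    + exists (mkposreal 1 Rlt_0_1). intros y _. apply (@RInt_correct R_CompleteNormedModule).
      apply ex_RInt_of_continuous. apply along; exact ZL.
    + apply along; exact ZL.
Qed.

(** At y = x the two curves differ by at most m |x - x'|, since the second one
    takes the value t0 at x'.  From there on the difference D satisfies
    |D'| <= K |D|, and K L <= 1/2 lets the maximum of |D| be absorbed. *)
Lemma characteristic_close (mu : R -> R -> R) (K m L t0 x x' : R) (tau tau' : R -> R) :
  0 <= K -> K * L <= / 2 -> Icc 0 L x -> Icc 0 L x' ->
  (forall t x t' x', Rabs (mu t x - mu t' x') <= K * (Rabs (t - t') + Rabs (x - x'))) ->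
  (forall t x, Rabs (mu t x) <= m) ->
  tau x = t0 -> tau' x' = t0 ->
  (forall y, Icc 0 L y -> is_derive tau y (mu (tau y) y)) ->
  (forall y, Icc 0 L y -> is_derive tau' y (mu (tau' y) y)) ->
  forall y, Icc 0 L y -> Rabs (tau y - tau' y) <= 2 * m * Rabs (x - x').
Proof.
  intros hK hKL hx hx' Hlip Hm E E' H H'.
  assert (hL : 0 <= L) by (destruct hx; lra).
  set (D := fun y => tau y - tau' y).
  assert (HD : forall y, Icc 0 L y -> is_derive D y (mu (tau y) y - mu (tau' y) y))
    by (intros y hy; apply (is_derive_minus tau tau'); auto).
  assert (Hc : forall y, Icc 0 L y -> continuity_pt (fun y => Rabs (D y)) y).
  { intros y hy. apply continuity_pt_filterlim.
    apply (continuous_comp D Rabs); [|apply continuous_Rabs].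
    apply (ex_derive_continuous D). eexists; apply HD; exact hy. }
  destruct (continuity_ab_maj (fun y => Rabs (D y)) 0 L hL Hc) as [y0 [Hmax hy0]].
  assert (hM := Rabs_pos (D y0)).
  set (M := Rabs (D y0)) in *.
  assert (h1 : Rabs (D y0 - D x) <= K * M * Rabs (y0 - x)).
  { apply (D_in_bound_lipschitz 0 L D (fun y => mu (tau y) y - mu (tau' y) y));
      [| |exact hx|exact hy0].
    - intros z hz. apply is_derive_D_in. auto.
    - intros z hz. apply Rle_trans with (1 := Hlip _ _ _ _).
      replace (z - z) with 0 by ring. rewrite Rabs_R0, Rplus_0_r.
      apply Rmult_le_compat_l; [exact hK|apply Hmax; exact hz]. }
  assert (h2 : Rabs (D x) <= m * Rabs (x - x')).
  { unfold D. rewrite E, <- E'. rewrite Rabs_minus_sym.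
    apply (D_in_bound_lipschitz 0 L tau' (fun y => mu (tau' y) y)); auto.
    intros z hz. apply is_derive_D_in. auto. }
  assert (h3 : Rabs (y0 - x) <= L) by (destruct hx; apply Rabs_le; lra).
  assert (h4 : K * M * Rabs (y0 - x) <= / 2 * M).
  { apply Rle_trans with (K * M * L).
    - apply Rmult_le_compat_l; [apply Rmult_le_pos|]; assumption.
    - replace (K * M * L) with (K * L * M) by ring.
      apply Rmult_le_compat_r; assumption. }
  assert (h5 : M <= Rabs (D x) + Rabs (D y0 - D x)).
  { unfold M. replace (D y0) with (D x + (D y0 - D x)) at 1 by ring.
    apply Rabs_triang. }
  intros y hy. apply Rle_trans with (1 := Hmax y hy). fold M. lra.
Qed.

(** * Reaching the sides of the rectangle *)

Definition between a b x := Icc (Rmin a b) (Rmax a b) x.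

Lemma signed_monotone s L tau q y z :
  (forall y, Icc 0 L y -> is_derive tau y (q y)) ->
  (forall y, Icc 0 L y -> 0 < s * q y) -> 0 <= y -> y <= z -> z <= L ->
  s * tau y <= s * tau z.
Proof.
  intros H Hq hy hyz hz.
  destruct (D_in_MVT_sub 0 L tau q y z) as [c [_ [hc E]]];
    try (split; lra); [intros; apply is_derive_D_in; auto|].
  assert (h := Hq c hc). nra.
Qed.

(** A monotone curve that spans a time less than T over [0,L] cannot leave
    [0,T] both to the left and to the right of x0: if it does so on one
    side, it stays in [0,T] all the way to the other. *)
Lemma reach_side s T L tau q m x0 :
  s = 1 \/ s = -1 -> 0 <= L -> m * L < T ->
  (forall y, Icc 0 L y -> is_derive tau y (q y)) ->
  (forall y, Icc 0 L y -> 0 < s * q y /\ Rabs (q y) <= m) ->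
  Icc 0 L x0 -> Icc 0 T (tau x0) ->
  exists e, (e = 0 \/ e = L) /\ forall y, between x0 e y -> Icc 0 T (tau y).
Proof.
  intros hs hL hmL H Hq hx0 ht0.
  assert (hspan : Rabs (tau L - tau 0) <= m * L).
  { replace L with (Rabs (L - 0)) at 2 by (rewrite Rabs_pos_eq; lra).
    apply (D_in_bound_lipschitz 0 L tau q); try (split; lra).
    - intros z hz. apply is_derive_D_in; auto.
    - intros z hz. apply Hq; exact hz. }
  apply Rabs_le_between in hspan. unfold between, Icc in *.
  assert (mono : forall y z, 0 <= y -> y <= z -> z <= L -> s * tau y <= s * tau z)
    by (intros y z; apply (signed_monotone s L tau q); [exact H|apply Hq]).
  assert (left_side : s = 1 /\ 0 <= tau 0 \/ s = -1 /\ tau 0 <= T \/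
    s = 1 /\ tau 0 < 0 \/ s = -1 /\ T < tau 0).
  { destruct hs as [-> | ->]; [destruct (Rle_dec 0 (tau 0))|destruct (Rle_dec (tau 0) T)]; lra. }
  destruct left_side as [h|[h|h]].
  - exists 0. split; [tauto|]. rewrite Rmin_right, Rmax_left by lra.
    intros y hy. assert (h1 := mono 0 y). assert (h2 := mono y x0).
    destruct h as [-> h]; lra.
  - exists 0. split; [tauto|]. rewrite Rmin_right, Rmax_left by lra.
    intros y hy. assert (h1 := mono 0 y). assert (h2 := mono y x0).
    destruct h as [-> h]; lra.
  - exists L. split; [tauto|]. rewrite Rmin_left, Rmax_right by lra.
    intros y hy. assert (h1 := mono x0 y). assert (h2 := mono y L).
    destruct h as [[-> h]|[-> h]]; lra.
Qed.

(** Curves leaving t = 0 in increasing time all go to the same side, determined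
    by the sign s, so that two of them can be compared where they arrive. *)
Lemma reach_side_from_start s T L m :
  s = 1 \/ s = -1 -> 0 <= L -> m * L < T ->
  exists e, (e = 0 \/ e = L) /\ forall tau q x0,
  (forall y, Icc 0 L y -> is_derive tau y (q y)) ->
  (forall y, Icc 0 L y -> 0 < s * q y /\ Rabs (q y) <= m) ->
  Icc 0 L x0 -> tau x0 = 0 ->
  forall y, between x0 e y -> Icc 0 T (tau y).
Proof.
  intros hs hL hmL.
  assert (span : forall tau q x0,
    (forall y, Icc 0 L y -> is_derive tau y (q y)) ->
    (forall y, Icc 0 L y -> 0 < s * q y /\ Rabs (q y) <= m) ->
    Icc 0 L x0 -> tau x0 = 0 -> forall y, Icc 0 L y -> Rabs (tau y) <= m * L).
  { intros tau q x0 H Hq hx0 E y hy.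
    replace (tau y) with (tau y - tau x0) by lra.
    apply Rle_trans with (m * Rabs (y - x0)).
    - apply (D_in_bound_lipschitz 0 L tau q); try assumption.
      + intros z hz. apply is_derive_D_in; auto.
      + intros z hz. apply Hq; exact hz.
    - apply Rmult_le_compat_l.
      + apply Rle_trans with (1 := Rabs_pos (q x0)). apply Hq; exact hx0.
      + destruct hx0, hy. apply Rabs_le; lra. }
  unfold between, Icc in *.
  exists (if Rlt_dec 0 s then L else 0).
  split; [destruct (Rlt_dec 0 s); tauto|].
  intros tau q x0 H Hq hx0 E y hy.
  assert (mono : forall y z, 0 <= y -> y <= z -> z <= L -> s * tau y <= s * tau z)
    by (intros u z; apply (signed_monotone s L tau q); [exact H|apply Hq]).
  assert (h1 := span tau q x0 H Hq hx0 E y). assert (h2 := Rle_abs (tau y)).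
  destruct (Rlt_dec 0 s) as [h|h]; destruct hs as [-> | ->]; try lra.
  - rewrite Rmin_left, Rmax_right in hy by lra. assert (h3 := mono x0 y). lra.
  - rewrite Rmin_right, Rmax_left in hy by lra. assert (h3 := mono y x0). lra.
Qed.

(** Chain rule along a curve that may run on the boundary of the rectangle.
    The increment is split into a variation in t at the new abscissa, treated
    by the mean value theorem and the continuity of u_t, and a variation in x
    at the old time, treated by the derivative u_x at the point. *)
Lemma D_in_along_curve T L u tau q a b y :
  0 < T -> 0 < L -> 0 <= a -> b <= L -> C1_rect T L u ->
  (forall z, Icc a b z -> Icc 0 T (tau z)) ->
  is_derive tau y q -> Icc a b y ->
  D_in (fun z => u (tau z) z)
    (fun _ => Dt T u (tau y) y * q + Dx L u (tau y) y) (Icc a b) y.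
Proof.
  intros hT hL ha hb [Hd [_ [Hct _]]] Hcurve Hq hy.
  assert (hpos : forall z, Icc a b z -> Icc 0 L z) by (intros z [h1 h2]; split; lra).
  assert (hrect : rect T L (tau y, y)) by (split; [apply Hcurve; exact hy|auto]).
  assert (Hx : D_in (fun z => u (tau y) z) (fun _ => Dx L u (tau y) y) (Icc a b) y).
  { apply (D_in_subset 0 L); [exact ha|exact hb|].
    apply (Derive_on_correct 0 L (fun z => u (tau y) z)); [exact hL|auto|].
    apply Hd; exact hrect. }
  assert (Htau : D_in tau (fun _ => q) (Icc a b) y) by (apply is_derive_D_in; exact Hq).
  rewrite D_in_eps in Hx, Htau |- *. intros eps he.
  set (w := Dt T u (tau y) y). assert (hw := Rabs_pos w). assert (hq := Rabs_pos q).
  (* eta bounds the oscillation of u_t, zeta the error of the linear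
     approximation of tau; both are spread over |q| and |u_t|. *)
  set (eta := eps / (2 * (Rabs q + 1))).
  assert (heta : 0 < eta) by (apply Rdiv_lt_0_compat; lra).
  assert (Eeta : eta * (Rabs q + 1) = eps / 2) by (unfold eta; field; lra).
  set (zeta := Rmin 1 (eps / (4 * (Rabs w + 1)))).
  assert (hzeta : 0 < zeta)
    by (apply Rmin_glb_lt; [lra|apply Rdiv_lt_0_compat; lra]).
  assert (hz1 : zeta <= 1) by apply Rmin_l.
  assert (hz2 : (Rabs w + 1) * zeta <= eps / 4).
  { replace (eps / 4) with ((Rabs w + 1) * (eps / (4 * (Rabs w + 1)))) by (field; lra).
    apply Rmult_le_compat_l; [lra|apply Rmin_r]. }
  destruct (Hx (eps / 4)) as [d1 [hd1 H1]]; [lra|].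
  destruct (Htau zeta hzeta) as [d2 [hd2 H2]].
  destruct (proj1 (filterlim_locally _ _) (Hct (tau y, y) hrect) (mkposreal eta heta))
    as [d3 H3].
  assert (hd3 := cond_pos d3).
  assert (hd4 : 0 < d3 / (Rabs q + 1)) by (apply Rdiv_lt_0_compat; lra).
  exists (Rmin (Rmin d1 d2) (Rmin d3 (d3 / (Rabs q + 1)))).
  split; [repeat apply Rmin_glb_lt; assumption|].
  intros z hz hzy.
  apply Rmin_Rgt_l in hzy. destruct hzy as [ha1 ha2].
  apply Rmin_Rgt_l in ha1. destruct ha1 as [hb1 hb2].
  apply Rmin_Rgt_l in ha2. destruct ha2 as [hb3 hb4].
  assert (hr := Rabs_pos (z - y)). set (r := Rabs (z - y)) in *.
  assert (k1 := H1 z hz hb1). assert (k2 := H2 z hz hb2). fold r in k1, k2.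
  assert (k3 : Rabs (tau z - tau y) <= (Rabs q + 1) * r).
  { replace (tau z - tau y) with ((tau z - tau y - q * (z - y)) + q * (z - y)) by ring.
    apply Rle_trans with (1 := Rabs_triang _ _). rewrite Rabs_mult. fold r. nra. }
  assert (k4 : (Rabs q + 1) * r < d3).
  { apply Rlt_le_trans with ((Rabs q + 1) * (d3 / (Rabs q + 1))).
    - apply Rmult_lt_compat_l; lra.
    - right; field; lra. }
  destruct (D_in_MVT_sub 0 T (fun t => u t z) (fun t => Dt T u t z) (tau y) (tau z))
    as [c [[hc1 hc2] [hc E]]]; [|auto|auto|].
  { intros t ht. apply (Derive_on_correct 0 T (fun t => u t z)); [exact hT|exact ht|].
    apply (Hd t z). split; [exact ht|apply hpos; exact hz]. }
  assert (k5 : Rabs (Dt T u c z - w) <= eta).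
  { left. apply (H3 (c, z)); [|split; [exact hc|apply hpos; exact hz]].
    split; [|exact hb3].
    change (Rabs (c - tau y) < d3).
    apply Rle_lt_trans with (Rabs (tau z - tau y)); [|lra].
    revert hc1 hc2. unfold Rmin, Rmax, Rabs.
    repeat destruct (Rle_dec _ _); repeat destruct (Rcase_abs _); lra. }
  match goal with |- Rabs ?e <= _ => replace e with
    ((Dt T u c z - w) * (tau z - tau y) + (w * (tau z - tau y - q * (z - y))
      + (u (tau y) z - u (tau y) y - Dx L u (tau y) y * (z - y)))) end.
  2:{ replace (u (tau z) z) with (u (tau y) z + Dt T u c z * (tau z - tau y)) by lra.
      ring. }
  apply Rle_trans with (1 := Rabs_triang _ _).
  assert (k6 : Rabs ((Dt T u c z - w) * (tau z - tau y)) <= eps / 2 * r).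
  { rewrite Rabs_mult, <- Eeta, Rmult_assoc.
    apply Rmult_le_compat; try apply Rabs_pos; assumption. }
  assert (k7 : Rabs (w * (tau z - tau y - q * (z - y))) <= eps / 4 * r).
  { rewrite Rabs_mult.
    apply Rle_trans with (Rabs w * (zeta * r)); [apply Rmult_le_compat_l; assumption|].
    nra. }
  assert (k8 := Rabs_triang (w * (tau z - tau y - q * (z - y)))
    (u (tau y) z - u (tau y) y - Dx L u (tau y) y * (z - y))).
  lra.
Qed.

(** * Riemann invariants near a subcritical equilibrium *)

Definition celerity g H a := sqrt (g * a * Derive H a).
Definition speed g H s a v := v + s * celerity g H a.
Definition potential g H Ae a := RInt (fun b => celerity g H b / b) Ae a.
Definition riemann g H Ae s a v := v + s * potential g H Ae a.
Definition discharge (a v : R) := a * v.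
Definition box Ae Ve r a v := Rabs (a - Ae) <= r /\ Rabs (v - Ve) <= r.

Lemma celerity_sq g H a : 0 < g -> 0 < a -> 0 < Derive H a ->
  celerity g H a * celerity g H a = g * a * Derive H a.
Proof.
  intros hg ha h. apply sqrt_sqrt. left. repeat apply Rmult_lt_0_compat; assumption.
Qed.

Lemma is_derive_potential g H Ae a :
  (forall b, 0 < b -> continuous (Derive H) b) -> 0 < Ae -> 0 < a ->
  is_derive (potential g H Ae) a (celerity g H a / a).
Proof.
  intros hH hAe ha.
  assert (hc : forall b, 0 < b -> continuous (fun b => celerity g H b / b) b).
  { intros b hb. unfold celerity, Rdiv.
    apply (continuous_mult (fun b => sqrt (g * b * Derive H b)) (fun b => / b)).
    - apply (continuous_comp (fun b => g * b * Derive H b) sqrt).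
      + apply (continuous_mult (fun b => g * b) (Derive H)); [|apply hH; exact hb].
        apply (continuous_mult (fun _ => g) (fun b => b));
          [apply continuous_const|apply continuous_id].
      + apply continuous_sqrt.
    - apply continuous_Rinv. lra. }
  apply (is_derive_RInt (fun b => celerity g H b / b) _ Ae); [|exact (hc a ha)].
  exists (mkposreal a ha). intros y hy.
  change (Rabs (y - a) < a) in hy. apply Rabs_def2 in hy.
  apply (@RInt_correct R_CompleteNormedModule).
  apply (@ex_RInt_continuous R_CompleteNormedModule). intros z [hz _].
  apply hc. apply Rlt_le_trans with (2 := hz). apply Rmin_glb_lt; lra.
Qed.

(** What is used of the nonlinearities near the equilibrium, with one constant K
    for all Lipschitz bounds: [rb_speed_sign] states that the speed l_s has the
    sign of s and modulus at least l0, and (A,V), (R_1,R_-1), (S,Q) are three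
    bi-Lipschitz equivalent systems of coordinates. *)
Record regular_box g Y H Ae Ve r l0 K : Prop := {
  rb_r : 0 < r;
  rb_K : 1 <= K;
  rb_area : forall a, Rabs (a - Ae) <= r -> 0 < a;
  rb_celerity_sq : forall a, Rabs (a - Ae) <= r ->
    celerity g H a * celerity g H a = g * a * Derive H a;
  rb_potential : forall a, Rabs (a - Ae) <= r ->
    is_derive (potential g H Ae) a (celerity g H a / a);
  rb_slope : forall a, Rabs (a - Ae) <= r -> Rabs (celerity g H a / a) <= K;
  rb_speed_sign : forall s a v, s = 1 \/ s = -1 -> box Ae Ve r a v ->
    l0 <= s * speed g H s a v;
  rb_speed_lip : forall s a v b w, s = 1 \/ s = -1 ->
    box Ae Ve r a v -> box Ae Ve r b w ->
    Rabs (speed g H s a v - speed g H s b w) <= K * (Rabs (a - b) + Rabs (v - w));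
  rb_riemann_lip : forall s a v b w, s = 1 \/ s = -1 ->
    box Ae Ve r a v -> box Ae Ve r b w ->
    Rabs (riemann g H Ae s a v - riemann g H Ae s b w)
      <= K * (Rabs (a - b) + Rabs (v - w));
  rb_riemann_inv : forall a v b w, box Ae Ve r a v -> box Ae Ve r b w ->
    Rabs (a - b) + Rabs (v - w) <=
    K * (Rabs (riemann g H Ae 1 a v - riemann g H Ae 1 b w)
       + Rabs (riemann g H Ae (-1) a v - riemann g H Ae (-1) b w));
  rb_SQ_lip : forall a v b w, box Ae Ve r a v -> box Ae Ve r b w ->
    Rabs (S_fun g Y H a v - S_fun g Y H b w) + Rabs (discharge a v - discharge b w)
      <= K * (Rabs (a - b) + Rabs (v - w));
  rb_SQ_inv : forall a v b w, box Ae Ve r a v -> box Ae Ve r b w ->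
    Rabs (a - b) + Rabs (v - w) <=
    K * (Rabs (S_fun g Y H a v - S_fun g Y H b w)
       + Rabs (discharge a v - discharge b w))
}.

Arguments rb_r {g Y H Ae Ve r l0 K}.
Arguments rb_K {g Y H Ae Ve r l0 K}.
Arguments rb_area {g Y H Ae Ve r l0 K}.
Arguments rb_celerity_sq {g Y H Ae Ve r l0 K}.
Arguments rb_potential {g Y H Ae Ve r l0 K}.
Arguments rb_slope {g Y H Ae Ve r l0 K}.
Arguments rb_speed_sign {g Y H Ae Ve r l0 K}.
Arguments rb_speed_lip {g Y H Ae Ve r l0 K}.
Arguments rb_riemann_lip {g Y H Ae Ve r l0 K}.
Arguments rb_riemann_inv {g Y H Ae Ve r l0 K}.
Arguments rb_SQ_lip {g Y H Ae Ve r l0 K}.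
Arguments rb_SQ_inv {g Y H Ae Ve r l0 K}.

Lemma mvt_near f df Ae r a b :
  (forall x, Rabs (x - Ae) <= r -> is_derive f x (df x)) ->
  Rabs (a - Ae) <= r -> Rabs (b - Ae) <= r ->
  exists c, Rabs (c - Ae) <= r /\ f a - f b = df c * (a - b).
Proof.
  intros H ha hb.
  assert (conv : forall x, Icc (Ae - r) (Ae + r) x <-> Rabs (x - Ae) <= r).
  { intros x. rewrite Rabs_le_between. unfold Icc. split; lra. }
  destruct (D_in_MVT_sub (Ae - r) (Ae + r) f df b a) as [c [_ [hc E]]].
  - intros z hz. apply is_derive_D_in. apply H. apply conv; exact hz.
  - apply conv; exact hb.
  - apply conv; exact ha.
  - exists c. split; [apply conv; exact hc|exact E].
Qed.

(** Everything follows by continuity from the values at the equilibrium, with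
    [nu] (later L/T) strictly below both |lambda_1| and lambda_2. The local
    Lipschitz continuity of H' makes the speeds Lipschitz.  For (S,Q), the mean
    value theorem gives the increments as a symmetric matrix ((P,N),(N,M))
    applied to the increments of (A,V), with a determinant close to the
    subcriticality gap g Ae H'(Ae) - Ve^2 > 0. *)
Lemma regular_box_exists g Y H Ae Ve nu :
  0 < g ->
  (forall a, 0 < a -> ex_derive H a /\ continuous (Derive H) a /\ 0 < Derive H a) ->
  (exists r k, 0 < r /\
     forall a b, Rabs (a - Ae) <= r -> Rabs (b - Ae) <= r ->
       Rabs (Derive H a - Derive H b) <= k * Rabs (a - b)) ->
  0 < Ae -> Ve ^ 2 < g * Ae * Derive H Ae ->
  nu < - lambda1 g H Ae Ve -> nu < lambda2 g H Ae Ve ->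
  exists r l0 K, nu < l0 /\ regular_box g Y H Ae Ve r l0 K.
Proof.
  intros hg hH [r0 [k' [hr0 Hk']]] hAe hsub hl1 hl2.
  set (p := Derive H Ae) in *.
  assert (hp : 0 < p) by (apply hH; exact hAe).
  set (k := Rmax k' 0).
  assert (hk : 0 <= k) by apply Rmax_r.
  assert (Hk : forall a b, Rabs (a - Ae) <= r0 -> Rabs (b - Ae) <= r0 ->
       Rabs (Derive H a - Derive H b) <= k * Rabs (a - b)).
  { intros a b ha hb. apply Rle_trans with (1 := Hk' a b ha hb).
    apply Rmult_le_compat_r; [apply Rabs_pos|apply Rmax_l]. }
  (* On the box a >= Ae/2 and H'(a) >= p/2, whence c(a) >= c0. *)
  set (c0 := sqrt (g * Ae * p / 4)).
  assert (hgap : 0 < g * Ae * p) by (repeat apply Rmult_lt_0_compat; assumption).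
  assert (hc0 : 0 < c0) by (apply sqrt_lt_R0; lra).
  (* k1 is a Lipschitz constant of a -> g a H'(a) on the box, and Kc one of its
     square root c. *)
  set (k1 := g * (3 * Ae / 2 * k + 3 * p / 2)).
  assert (hk1 : 0 <= k1).
  { apply Rmult_le_pos; [lra|]. assert (0 <= 3 * Ae / 2 * k); [|lra].
    apply Rmult_le_pos; lra. }
  set (Kc := k1 / (2 * c0)).
  assert (hKc : 0 <= Kc) by (apply Rdiv_le_0_compat; lra).
  set (ce := celerity g H Ae).
  assert (El1 : - lambda1 g H Ae Ve = ce - Ve) by (unfold lambda1, ce, celerity; ring).
  assert (El2 : lambda2 g H Ae Ve = ce + Ve) by (unfold lambda2, ce, celerity; ring).
  rewrite El1 in hl1. rewrite El2 in hl2.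
  set (mn := Rmin (ce - Ve) (ce + Ve)).
  assert (hmn : nu < mn) by (apply Rmin_glb_lt; assumption).
  set (d := g * Ae * p - Ve ^ 2). assert (hd : 0 < d) by (unfold d; lra).
  assert (hV := Rabs_pos Ve).
  (* Within distance r <= 1 of the equilibrium, the determinant P M - N^2 loses
     at most W r. *)
  set (W := g * (k * Ae + p) + 2 * Rabs Ve + 1).
  assert (hW : 0 < W).
  { assert (0 <= k * Ae) by (apply Rmult_le_pos; lra).
    assert (0 <= g * (k * Ae + p)) by (apply Rmult_le_pos; lra). unfold W. lra. }
  assert (Hr : exists r, 0 < r /\ r <= r0 /\ r <= Ae / 2 /\ k * r <= p / 2 /\ r <= 1 /\
    (1 + Kc) * r <= (mn - nu) / 2 /\ W * r <= d / 2).
  { set (r := Rmin (Rmin r0 (Rmin (Ae / 2) (p / 2 / (k + 1))))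
      (Rmin 1 (Rmin ((mn - nu) / 2 / (1 + Kc)) (d / 2 / W)))).
    assert (hr : 0 < r).
    { repeat apply Rmin_glb_lt; try lra; apply Rdiv_lt_0_compat; lra. }
    assert (hle := Rle_refl r). unfold r at 2 in hle.
    assert (E : forall u v w, w <= Rmin u v -> w <= u /\ w <= v).
    { intros u v w h. split; [apply Rle_trans with (1 := h); apply Rmin_l|
        apply Rle_trans with (1 := h); apply Rmin_r]. }
    apply E in hle. destruct hle as [h1 h2].
    apply E in h1. destruct h1 as [h1 h3]. apply E in h3. destruct h3 as [h3 h4].
    apply E in h2. destruct h2 as [h2 h5]. apply E in h5. destruct h5 as [h5 h6].
    exists r. repeat split; try assumption.
    - apply Rle_trans with ((k + 1) * r); [lra|].
      replace (p / 2) with ((k + 1) * (p / 2 / (k + 1))) by (field; lra).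
      apply Rmult_le_compat_l; lra.
    - replace ((mn - nu) / 2) with ((1 + Kc) * ((mn - nu) / 2 / (1 + Kc))) by (field; lra).
      apply Rmult_le_compat_l; lra.
    - replace (d / 2) with (W * (d / 2 / W)) by (field; lra).
      apply Rmult_le_compat_l; lra. }
  destruct Hr as [r [hr [hr1 [hr2 [hr3 [hr4 [hr5 hr6]]]]]]].
  set (B := fun a => Rabs (a - Ae) <= r).
  assert (hBe : B Ae).
  { unfold B. replace (Ae - Ae) with 0 by ring. rewrite Rabs_R0. lra. }
  assert (Barea : forall a, B a -> Ae / 2 <= a <= 3 * Ae / 2).
  { intros a ha. apply Rabs_le_between in ha. lra. }
  assert (Bp : forall a, B a -> Rabs (Derive H a - p) <= k * r).
  { intros a ha. unfold B in ha. apply Rle_trans with (k * Rabs (a - Ae)).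
    - apply Hk; [lra|]. unfold B in hBe. lra.
    - apply Rmult_le_compat_l; assumption. }
  assert (Bp' : forall a, B a -> p / 2 <= Derive H a <= 3 * p / 2).
  { intros a ha. assert (h := Bp a ha). apply Rabs_le_between in h. lra. }
  assert (Bc : forall a, B a -> c0 <= celerity g H a).
  { intros a ha. apply sqrt_le_1_alt.
    assert (h1 := Barea a ha). assert (h2 := Bp' a ha).
    assert (h3 : Ae / 2 * (p / 2) <= a * Derive H a) by (apply Rmult_le_compat; lra).
    assert (h4 := Rmult_le_compat_l g _ _ (Rlt_le _ _ hg) h3). lra. }
  assert (Bclip : forall a b, B a -> B b ->
    Rabs (celerity g H a - celerity g H b) <= Kc * Rabs (a - b)).
  { intros a b ha hb.
    assert (h1 := Bc a ha). assert (h2 := Bc b hb).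
    assert (h3 := Barea a ha). assert (h4 := Barea b hb).
    assert (h5 := Bp' a ha). assert (h6 := Bp' b hb).
    assert (h7 : Rabs (g * a * Derive H a - g * b * Derive H b) <= k1 * Rabs (a - b)).
    { replace (g * a * Derive H a - g * b * Derive H b)
        with (g * (a * (Derive H a - Derive H b) + Derive H b * (a - b))) by ring.
      rewrite Rabs_mult, (Rabs_pos_eq g) by lra. unfold k1. rewrite Rmult_assoc.
      apply Rmult_le_compat_l; [lra|].
      apply Rle_trans with (1 := Rabs_triang _ _). rewrite !Rabs_mult.
      rewrite (Rabs_pos_eq a), (Rabs_pos_eq (Derive H b)) by lra.
      assert (h8 := Hk a b ltac:(unfold B in ha; lra) ltac:(unfold B in hb; lra)).
      assert (h9 : a * Rabs (Derive H a - Derive H b) <= 3 * Ae / 2 * (k * Rabs (a - b)))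
        by (apply Rmult_le_compat; try lra; apply Rabs_pos).
      assert (h10 : Derive H b * Rabs (a - b) <= 3 * p / 2 * Rabs (a - b))
        by (apply Rmult_le_compat_r; [apply Rabs_pos|lra]).
      lra. }
    rewrite <- (celerity_sq g H a), <- (celerity_sq g H b) in h7 by lra.
    set (x := celerity g H a) in *. set (y := celerity g H b) in *.
    replace (x * x - y * y) with ((x + y) * (x - y)) in h7 by ring.
    rewrite Rabs_mult, (Rabs_pos_eq (x + y)) in h7 by lra.
    assert (h8 : 2 * c0 * Rabs (x - y) <= (x + y) * Rabs (x - y))
      by (apply Rmult_le_compat_r; [apply Rabs_pos|lra]).
    apply Rmult_le_reg_l with (2 * c0); [lra|].
    replace (2 * c0 * (Kc * Rabs (a - b))) with (k1 * Rabs (a - b))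
      by (unfold Kc; field; lra).
    lra. }
  (* k0 and Kp bound the slope c(a)/a of the potential. *)
  set (k0 := c0 / (3 * Ae / 2)).
  assert (hk0 : 0 < k0) by (apply Rdiv_lt_0_compat; lra).
  set (Kp := (ce + Kc * r) / (Ae / 2)).
  assert (hcer : c0 <= ce + Kc * r).
  { assert (h := Bc Ae hBe). assert (0 <= Kc * r) by (apply Rmult_le_pos; lra).
    unfold ce. lra. }
  assert (hKp : 0 <= Kp) by (apply Rdiv_le_0_compat; lra).
  assert (Bslope : forall a, B a -> k0 <= celerity g H a / a <= Kp).
  { intros a ha. assert (h1 := Bc a ha). assert (h2 := Barea a ha).
    assert (h3 := Bclip a Ae ha hBe). fold ce in h3.
    assert (h4 : Kc * Rabs (a - Ae) <= Kc * r) by (apply Rmult_le_compat_l; assumption).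
    assert (h5 := Rle_abs (celerity g H a - ce)).
    split; unfold k0, Kp, Rdiv.
    - apply Rmult_le_compat; try lra; [left; apply Rinv_0_lt_compat; lra|].
      apply Rinv_le_contravar; lra.
    - apply Rmult_le_compat; try lra; [left; apply Rinv_0_lt_compat; lra|].
      apply Rinv_le_contravar; lra. }
  assert (Bder : forall a, B a -> is_derive (potential g H Ae) a (celerity g H a / a)).
  { intros a ha. assert (h := Barea a ha).
    apply is_derive_potential; try lra. intros b hb. apply hH; exact hb. }
  assert (Bpot : forall a b, B a -> B b ->
    k0 * Rabs (a - b) <= Rabs (potential g H Ae a - potential g H Ae b) <= Kp * Rabs (a - b)).
  { intros a b ha hb.
    destruct (mvt_near (potential g H Ae) (fun a => celerity g H a / a) Ae r a b)
      as [c [hc E]]; [|exact ha|exact hb|].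
    { exact Bder. }
    assert (h := Bslope c hc).
    rewrite E, Rabs_mult, (Rabs_pos_eq (celerity g H c / c)) by lra.
    split; apply Rmult_le_compat_r; try apply Rabs_pos; lra. }
  set (Kq := 2 * Ae + (Rabs Ve + 1) + 2 * g * p).
  assert (hgp : 0 < g * p) by (apply Rmult_lt_0_compat; assumption).
  assert (hKq : 0 < Kq) by (unfold Kq; lra).
  (* P = g H'(c) at an intermediate point c, N and M are the means of the two
     velocities and of the two areas. *)
  assert (BSQ : forall a v b w, box Ae Ve r a v -> box Ae Ve r b w ->
    exists P N M, 0 <= P <= 2 * g * p /\ Rabs N <= Rabs Ve + 1 /\ 0 <= M <= 2 * Ae /\
      d / 2 <= P * M - N * N /\
      S_fun g Y H a v - S_fun g Y H b w = P * (a - b) + N * (v - w) /\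
      discharge a v - discharge b w = N * (a - b) + M * (v - w)).
  { intros a v b w [ha hv] [hb hw].
    destruct (mvt_near H (Derive H) Ae r a b) as [c [hc E]]; [|exact ha|exact hb|].
    { intros x hx. apply Derive_correct. apply hH. assert (h := Barea x hx). lra. }
    exists (g * Derive H c), ((v + w) / 2), ((a + b) / 2).
    assert (h1 := Barea a ha). assert (h2 := Barea b hb). assert (h3 := Bp' c hc).
    assert (h4 := Bp c hc).
    assert (hN : Rabs ((v + w) / 2) <= Rabs Ve + r).
    { replace ((v + w) / 2) with (Ve + ((v - Ve) / 2 + (w - Ve) / 2)) by field.
      apply Rle_trans with (1 := Rabs_triang _ _).
      apply Rplus_le_compat_l. apply Rle_trans with (1 := Rabs_triang _ _).
      unfold Rdiv. rewrite !Rabs_mult, (Rabs_pos_eq (/ 2)) by lra. lra. }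
    repeat split.
    - apply Rmult_le_pos; lra.
    - assert (h5 : g * Derive H c <= g * (3 * p / 2)) by (apply Rmult_le_compat_l; lra). lra.
    - lra.
    - lra.
    - lra.
    - assert (h5 : (v + w) / 2 * ((v + w) / 2) <= (Rabs Ve + r) * (Rabs Ve + r)).
      { apply Rle_trans with (Rabs ((v + w) / 2) * Rabs ((v + w) / 2)).
        - rewrite <- Rabs_mult. apply Rle_abs.
        - apply Rmult_le_compat; try apply Rabs_pos; assumption. }
      assert (h6 : (Rabs Ve + r) * (Rabs Ve + r) <= Ve ^ 2 + (2 * Rabs Ve + 1) * r).
      { assert (h7 : Rabs Ve * Rabs Ve = Ve ^ 2)
          by (rewrite <- Rabs_mult, Rabs_pos_eq; [ring|apply Rle_0_sqr]).
        assert (h8 : r * r <= 1 * r) by (apply Rmult_le_compat_r; lra). lra. }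
      assert (h7 : Ae - r <= (a + b) / 2).
      { apply Rabs_le_between in ha. apply Rabs_le_between in hb. lra. }
      assert (h8 : p - k * r <= Derive H c) by (apply Rabs_le_between in h4; lra).
      assert (h9 : (p - k * r) * (Ae - r) <= Derive H c * ((a + b) / 2))
        by (apply Rmult_le_compat; lra).
      assert (h10 := Rmult_le_compat_l g _ _ (Rlt_le _ _ hg) h9).
      assert (h11 : 0 <= g * (k * r * r)).
      { apply Rmult_le_pos; [lra|]. apply Rmult_le_pos; [apply Rmult_le_pos|]; lra. }
      unfold W in hr6. unfold d in *. lra.
    - unfold S_fun. replace (/ 2 * v ^ 2 + g * H a + g * Y - (/ 2 * w ^ 2 + g * H b + g * Y))
        with (/ 2 * (v ^ 2 - w ^ 2) + g * (H a - H b)) by ring.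
      rewrite E. field.
    - unfold discharge. field. }
  set (K := 1 + Kp + Kc + / k0 + Kq + Kq * (2 / d)).
  assert (hik0 : 0 < / k0) by (apply Rinv_0_lt_compat; exact hk0).
  assert (hKqd : 0 <= Kq * (2 / d)).
  { apply Rmult_le_pos; [lra|]. apply Rdiv_le_0_compat; lra. }
  assert (toK : forall x y K', 0 <= y -> K' <= K -> x <= K' * y -> x <= K * y).
  { intros x y K' hy hKK hx. apply Rle_trans with (1 := hx).
    apply Rmult_le_compat_r; assumption. }
  assert (abs_s : forall s x, s = 1 \/ s = -1 -> Rabs (s * x) = Rabs x).
  { intros s x [-> | ->]; rewrite Rabs_mult; [rewrite Rabs_R1|rewrite Rabs_m1]; ring. }
  exists r, ((mn + nu) / 2), K. split; [lra|].
  constructor.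
  - exact hr.
  - unfold K. lra.
  - intros a ha. assert (h := Barea a ha). lra.
  - intros a ha. assert (h := Barea a ha). assert (h' := Bp' a ha).
    apply celerity_sq; lra.
  - exact Bder.
  - intros a ha. assert (h := Bslope a ha). rewrite Rabs_pos_eq; unfold K; lra.
  - intros s a v hs [ha hv].
    assert (h1 := Bclip a Ae ha hBe). fold ce in h1.
    assert (h2 : Kc * Rabs (a - Ae) <= Kc * r) by (apply Rmult_le_compat_l; assumption).
    assert (h3 := proj1 (Rabs_le_between _ _) (Rle_trans _ _ _ h1 h2)).
    apply Rabs_le_between in hv.
    assert (h4 : mn <= ce - Ve) by apply Rmin_l.
    assert (h5 : mn <= ce + Ve) by apply Rmin_r.
    unfold speed. destruct hs as [-> | ->]; lra.
  - intros s a v b w hs [ha hv] [hb hw].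
    assert (h1 := Bclip a b ha hb).
    assert (h2 := Rabs_pos (a - b)). assert (h3 := Rabs_pos (v - w)).
    apply toK with (1 + Kc); [lra|unfold K; lra|].
    unfold speed.
    replace (v + s * celerity g H a - (w + s * celerity g H b))
      with ((v - w) + s * (celerity g H a - celerity g H b)) by ring.
    apply Rle_trans with (1 := Rabs_triang _ _). rewrite abs_s by exact hs. nra.
  - intros s a v b w hs [ha hv] [hb hw].
    assert (h1 := Bpot a b ha hb).
    assert (h2 := Rabs_pos (a - b)). assert (h3 := Rabs_pos (v - w)).
    apply toK with (1 + Kp); [lra|unfold K; lra|].
    unfold riemann.
    replace (v + s * potential g H Ae a - (w + s * potential g H Ae b))
      with ((v - w) + s * (potential g H Ae a - potential g H Ae b)) by ring.
    apply Rle_trans with (1 := Rabs_triang _ _). rewrite abs_s by exact hs. nra.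
  - intros a v b w [ha hv] [hb hw].
    assert (h1 := Bpot a b ha hb).
    set (x := riemann g H Ae 1 a v - riemann g H Ae 1 b w).
    set (y := riemann g H Ae (-1) a v - riemann g H Ae (-1) b w).
    assert (E1 : v - w = (x + y) / 2) by (unfold x, y, riemann; field).
    assert (E2 : potential g H Ae a - potential g H Ae b = (x + - y) / 2)
      by (unfold x, y, riemann; field).
    assert (hx := Rabs_pos x). assert (hy := Rabs_pos y).
    assert (h2 : Rabs (v - w) <= Rabs x + Rabs y).
    { rewrite E1. unfold Rdiv. rewrite Rabs_mult, (Rabs_pos_eq (/ 2)) by lra.
      assert (h := Rabs_triang x y). lra. }
    assert (h3 : k0 * Rabs (a - b) <= Rabs x + Rabs y).
    { apply Rle_trans with (1 := proj1 h1).
      rewrite E2. unfold Rdiv. rewrite Rabs_mult, (Rabs_pos_eq (/ 2)) by lra.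
      assert (h := Rabs_triang x (- y)). rewrite Rabs_Ropp in h. lra. }
    apply toK with (1 + / k0); [lra|unfold K; lra|].
    assert (h4 : Rabs (a - b) <= / k0 * (Rabs x + Rabs y)).
    { apply Rmult_le_reg_l with k0; [exact hk0|].
      rewrite <- Rmult_assoc, Rinv_r, Rmult_1_l by lra. exact h3. }
    lra.
  - intros a v b w hav hbw.
    destruct (BSQ a v b w hav hbw) as [P [N [M [hP [hN [hM [_ [ES EQ]]]]]]]].
    rewrite ES, EQ.
    assert (h2 := Rabs_pos (a - b)). assert (h3 := Rabs_pos (v - w)).
    assert (h4 := Rabs_pos N).
    apply toK with Kq; [lra|unfold K; lra|].
    assert (h5 := Rabs_triang (P * (a - b)) (N * (v - w))).
    assert (h6 := Rabs_triang (N * (a - b)) (M * (v - w))).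
    rewrite !Rabs_mult in h5, h6.
    rewrite (Rabs_pos_eq P) in h5 by lra. rewrite (Rabs_pos_eq M) in h6 by lra.
    assert (h7 : (P + Rabs N) * Rabs (a - b) <= Kq * Rabs (a - b))
      by (apply Rmult_le_compat_r; unfold Kq; lra).
    assert (h8 : (Rabs N + M) * Rabs (v - w) <= Kq * Rabs (v - w))
      by (apply Rmult_le_compat_r; unfold Kq; lra).
    lra.
  - intros a v b w hav hbw.
    destruct (BSQ a v b w hav hbw) as [P [N [M [hP [hN [hM [hD [ES EQ]]]]]]]].
    set (x := S_fun g Y H a v - S_fun g Y H b w) in *.
    set (y := discharge a v - discharge b w) in *.
    assert (hx := Rabs_pos x). assert (hy := Rabs_pos y).
    assert (E1 : (P * M - N * N) * (a - b) = M * x + - (N * y)) by (rewrite ES, EQ; ring).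
    assert (E2 : (P * M - N * N) * (v - w) = P * y + - (N * x)) by (rewrite ES, EQ; ring).
    assert (h1 := Rabs_triang (M * x) (- (N * y))).
    assert (h2 := Rabs_triang (P * y) (- (N * x))).
    rewrite <- E1 in h1. rewrite <- E2 in h2.
    rewrite Rabs_Ropp, !Rabs_mult, (Rabs_pos_eq (P * M - N * N)) in h1, h2 by lra.
    rewrite (Rabs_pos_eq M) in h1 by lra. rewrite (Rabs_pos_eq P) in h2 by lra.
    assert (h3 : (M + Rabs N) * Rabs x <= Kq * Rabs x)
      by (apply Rmult_le_compat_r; unfold Kq; lra).
    assert (h4 : (P + Rabs N) * Rabs y <= Kq * Rabs y)
      by (apply Rmult_le_compat_r; unfold Kq; lra).
    assert (h5 := Rabs_pos (a - b)). assert (h6 := Rabs_pos (v - w)).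
    assert (h7 : d / 2 * (Rabs (a - b) + Rabs (v - w))
      <= (P * M - N * N) * (Rabs (a - b) + Rabs (v - w)))
      by (apply Rmult_le_compat_r; lra).
    apply toK with (Kq * (2 / d)); [lra|unfold K; lra|].
    apply Rmult_le_reg_l with (d / 2); [lra|].
    replace (d / 2 * (Kq * (2 / d) * (Rabs x + Rabs y))) with (Kq * (Rabs x + Rabs y))
      by (field; lra).
    rewrite Rmult_plus_distr_l in h7 |- *.
    lra.
Qed.

(** * Solutions close to the equilibrium *)

(** The system is in the nonconservative form from which the transport of the
    invariants is read off.  The bound dl of the derivatives is kept apart from
    the radius r of the box: it is what makes characteristics exist on all of
    [0,L] and couplings weak, and it is 0 for the equilibrium. *)
Record small_solution g H T L Ae Ve r dl (A V : R -> R -> R) : Prop := {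
  ss_A : C1_rect T L A;
  ss_V : C1_rect T L V;
  ss_eq : forall t x, rect T L (t, x) ->
    Dt T A t x + V t x * Dx L A t x + A t x * Dx L V t x = 0 /\
    Dt T V t x + V t x * Dx L V t x + g * Derive H (A t x) * Dx L A t x = 0;
  ss_box : forall t x, rect T L (t, x) -> box Ae Ve r (A t x) (V t x);
  ss_small : forall t x, rect T L (t, x) ->
    Rabs (Dt T A t x) <= dl /\ Rabs (Dx L A t x) <= dl /\
    Rabs (Dt T V t x) <= dl /\ Rabs (Dx L V t x) <= dl
}.

Arguments ss_A {g H T L Ae Ve r dl A V}.
Arguments ss_V {g H T L Ae Ve r dl A V}.
Arguments ss_eq {g H T L Ae Ve r dl A V}.
Arguments ss_box {g H T L Ae Ve r dl A V}.
Arguments ss_small {g H T L Ae Ve r dl A V}.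

(** Expanding Q_x and S_x by the product and chain rules turns the conservation
    laws into the nonconservative form. *)
Lemma small_solution_of_mixed g Y L T H A0 V0 h hb A V Ae Ve r dl :
  0 < L -> 0 < T ->
  (forall a, 0 < a -> ex_derive H a /\ continuous (Derive H) a /\ 0 < Derive H a) ->
  mixed_problem_solution g Y L T H A0 V0 h hb A V ->
  C1_close T L Ae Ve dl A V -> dl <= r ->
  small_solution g H T L Ae Ve r dl A V.
Proof.
  intros hL hT hH [HA [HV [Heq _]]] [HcA HcV] hr.
  assert (KA := C1_rect_close T L A Ae dl hT hL HA HcA).
  assert (KV := C1_rect_close T L V Ve dl hT hL HV HcV).
  constructor; [exact HA|exact HV| | |].
  - intros t x hp. destruct (Heq t x hp) as [ha [e1 e2]].
    destruct hp as [ht hx]. simpl in ht, hx.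
    assert (hAx : D_in (fun y => A t y) (fun _ => Dx L A t x) (Icc 0 L) x).
    { apply (Derive_on_correct 0 L (fun y => A t y)); [exact hL|exact hx|].
      apply HA; split; assumption. }
    assert (hVx : D_in (fun y => V t y) (fun _ => Dx L V t x) (Icc 0 L) x).
    { apply (Derive_on_correct 0 L (fun y => V t y)); [exact hL|exact hx|].
      apply HV; split; assumption. }
    assert (E1 : Dx L (fun t x => A t x * V t x) t x
      = Dx L A t x * V t x + A t x * Dx L V t x).
    { apply Derive_on_unique; [exact hL|exact hx|].
      exact (D_in_mult 0 L _ _ _ _ x hAx hVx). }
    assert (E2 : Dx L (fun t x => S_fun g Y H (A t x) (V t x)) t x
      = V t x * Dx L V t x + g * Derive H (A t x) * Dx L A t x).
    { apply Derive_on_unique; [exact hL|exact hx|]. unfold S_fun.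
      rewrite <- (Rplus_0_r (_ + _)).
      apply (D_in_plus 0 L (fun y => / 2 * V t y ^ 2 + g * H (A t y))
        _ (fun _ => g * Y)); [|apply D_in_const].
      apply (D_in_plus 0 L (fun y => / 2 * V t y ^ 2) _ (fun y => g * H (A t y))).
      - apply (D_in_comp 0 L (fun y => V t y) _ (fun v => / 2 * v ^ 2) _ x hVx).
        auto_derive; [exact I|]. field.
      - apply (D_in_comp 0 L (fun y => A t y) _ (fun a => g * H a) _ x hAx).
        apply (is_derive_scal H). apply Derive_correct. apply hH; exact ha. }
    rewrite E1 in e1. rewrite E2 in e2. split; lra.
  - intros t x hp. destruct (KA t x hp) as [h1 _]. destruct (KV t x hp) as [h2 _].
    split; lra.
  - intros t x hp. destruct (KA t x hp) as [_ h1]. destruct (KV t x hp) as [_ h2].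
    tauto.
Qed.

Lemma const_C1_rect T L k : 0 < T -> 0 < L -> C1_rect T L (fun _ _ => k) /\
  forall t x, rect T L (t, x) ->
    Dt T (fun _ _ => k) t x = 0 /\ Dx L (fun _ _ => k) t x = 0.
Proof.
  intros hT hL.
  assert (E : forall t x, rect T L (t, x) ->
    Dt T (fun _ _ => k) t x = 0 /\ Dx L (fun _ _ => k) t x = 0).
  { intros t x [ht hx]. split; apply Derive_on_unique; try assumption; apply D_in_const. }
  assert (cst : forall c : R, continuous_on (rect T L) (fun _ : R * R => c)).
  { intros c p _. apply filterlim_const. }
  split; [|exact E]. split; [|split; [|split]].
  - intros t x _. split; exists 0; apply D_in_const.
  - apply cst.
  - apply continuous_on_eq with (2 := cst 0). intros [t x] hp. symmetry. apply E; exact hp.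
  - apply continuous_on_eq with (2 := cst 0). intros [t x] hp. symmetry. apply E; exact hp.
Qed.

Lemma equilibrium_small_solution g H T L Ae Ve r : 0 < T -> 0 < L -> 0 < r ->
  small_solution g H T L Ae Ve r 0 (fun _ _ => Ae) (fun _ _ => Ve).
Proof.
  intros hT hL hr.
  destruct (const_C1_rect T L Ae hT hL) as [CA EA].
  destruct (const_C1_rect T L Ve hT hL) as [CV EV].
  constructor; [exact CA|exact CV| | |]; intros t x hp;
    try (destruct (EA t x hp) as [e1 e2]; destruct (EV t x hp) as [e3 e4];
         rewrite e1, e2, e3, e4).
  - split; ring.
  - split; rewrite Rminus_diag, Rabs_R0; lra.
  - rewrite Rabs_R0. lra.
Qed.

Lemma C1_rect_lipschitz T L u dl : 0 < T -> 0 < L -> C1_rect T L u ->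
  (forall t x, rect T L (t, x) -> Rabs (Dt T u t x) <= dl /\ Rabs (Dx L u t x) <= dl) ->
  forall t x t' x', rect T L (t, x) -> rect T L (t', x') ->
    Rabs (u t x - u t' x') <= dl * (Rabs (t - t') + Rabs (x - x')).
Proof.
  intros hT hL [Hd _] Hb t x t' x' [ht hx] [ht' hx']. simpl in *.
  replace (u t x - u t' x') with ((u t x - u t' x) + (u t' x - u t' x')) by ring.
  apply Rle_trans with (1 := Rabs_triang _ _). rewrite Rmult_plus_distr_l.
  apply Rplus_le_compat.
  - apply (D_in_bound_lipschitz 0 T (fun s => u s x) (fun s => Dt T u s x)); try assumption.
    + intros z hz. apply (Derive_on_correct 0 T (fun s => u s x)); [exact hT|exact hz|].
      apply (Hd z x); split; assumption.
    + intros z hz. apply Hb; split; assumption.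
  - apply (D_in_bound_lipschitz 0 L (fun y => u t' y) (fun y => Dx L u t' y)); try assumption.
    + intros z hz. apply (Derive_on_correct 0 L (fun y => u t' y)); [exact hL|exact hz|].
      apply (Hd t' z); split; assumption.
    + intros z hz. apply Hb; split; assumption.
Qed.

Lemma small_solution_nonneg g H T L Ae Ve r dl A V :
  0 < T -> 0 < L -> small_solution g H T L Ae Ve r dl A V -> 0 <= dl.
Proof.
  intros hT hL SS. destruct (ss_small SS 0 0) as [h _]; [split; split; simpl; lra|].
  apply Rle_trans with (2 := h). apply Rabs_pos.
Qed.

(** The field 1 / l_s whose integral curves t(x) are the characteristics,
    extended to the whole plane. *)
Definition slope_field g H T L s (A V : R -> R -> R) t x :=
  / speed g H s (A (clamp 0 T t) (clamp 0 L x)) (V (clamp 0 T t) (clamp 0 L x)).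

(** The Lipschitz constant is proportional to dl, because the field varies only
    through A and V; this is why small solutions have characteristics over
    all of [0,L]. *)
Lemma slope_field_bounds g Y H T L Ae Ve r l0 K dl A V s :
  0 < T -> 0 < L -> 0 < l0 -> s = 1 \/ s = -1 ->
  regular_box g Y H Ae Ve r l0 K -> small_solution g H T L Ae Ve r dl A V ->
  0 <= 2 * K * dl / (l0 * l0) /\
  (forall t x, 0 < s * slope_field g H T L s A V t x /\
     Rabs (slope_field g H T L s A V t x) <= / l0) /\
  (forall t x t' x', Rabs (slope_field g H T L s A V t x - slope_field g H T L s A V t' x')
     <= 2 * K * dl / (l0 * l0) * (Rabs (t - t') + Rabs (x - x'))).
Proof.
  intros hT hL hl0 hs RB SS.
  assert (R0 : forall t x, rect T L (clamp 0 T t, clamp 0 L x))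
    by (intros t x; split; apply clamp_Icc; lra).
  assert (hK := rb_K RB).
  assert (Habs : forall t x, l0 <= Rabs (speed g H s (A (clamp 0 T t) (clamp 0 L x))
     (V (clamp 0 T t) (clamp 0 L x)))).
  { intros t x.
    assert (h := rb_speed_sign RB s _ _ hs (ss_box SS _ _ (R0 t x))).
    destruct hs as [-> | ->]; [rewrite Rabs_pos_eq|rewrite Rabs_left]; lra. }
  assert (hdl := small_solution_nonneg _ _ _ _ _ _ _ _ _ _ hT hL SS).
  split; [|split].
  - apply Rdiv_le_0_compat; [|nra]. apply Rmult_le_pos; lra.
  - intros t x. assert (h1 := Habs t x). unfold slope_field.
    assert (h := rb_speed_sign RB s _ _ hs (ss_box SS _ _ (R0 t x))).
    set (l := speed g H s _ _) in *. split.
    + destruct hs as [-> | ->].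
      * rewrite Rmult_1_l. apply Rinv_0_lt_compat; lra.
      * replace (-1 * / l) with (/ (-1 * l)) by (field; lra). apply Rinv_0_lt_compat; lra.
    + rewrite Rabs_inv. apply Rinv_le_contravar; assumption.
  - intros t x t' x'. assert (h1 := Habs t x). assert (h2 := Habs t' x').
    assert (h3 := rb_speed_lip RB s _ _ _ _ hs
      (ss_box SS _ _ (R0 t x)) (ss_box SS _ _ (R0 t' x'))).
    assert (hA := C1_rect_lipschitz T L A dl hT hL (ss_A SS)
      ltac:(intros u y hp; destruct (ss_small SS u y hp); tauto)
      _ _ _ _ (R0 t x) (R0 t' x')).
    assert (hV := C1_rect_lipschitz T L V dl hT hL (ss_V SS)
      ltac:(intros u y hp; destruct (ss_small SS u y hp); tauto)
      _ _ _ _ (R0 t x) (R0 t' x')).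
    assert (ht := clamp_lipschitz 0 T t t'). assert (hx := clamp_lipschitz 0 L x x').
    unfold slope_field.
    set (l := speed g H s (A (clamp 0 T t) _) _) in *.
    set (l' := speed g H s (A (clamp 0 T t') _) _) in *.
    assert (hl : l <> 0) by (intro e; rewrite e, Rabs_R0 in h1; lra).
    assert (hl' : l' <> 0) by (intro e; rewrite e, Rabs_R0 in h2; lra).
    replace (/ l - / l') with (- (l - l') * (/ l * / l')) by (field; split; assumption).
    rewrite Rabs_mult, Rabs_Ropp, Rabs_mult, !Rabs_inv.
    set (D := Rabs (t - t') + Rabs (x - x')).
    replace (2 * K * dl / (l0 * l0) * D) with (2 * K * dl * D * (/ l0 * / l0)) by (field; lra).
    apply Rmult_le_compat; [apply Rabs_pos| | |].
    + apply Rmult_le_pos; left; apply Rinv_0_lt_compat; lra.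
    + apply Rle_trans with (1 := h3).
      replace (2 * K * dl * D) with (K * (dl * D + dl * D)) by ring.
      apply Rmult_le_compat_l; [lra|].
      assert (h4 : dl * (Rabs (clamp 0 T t - clamp 0 T t') + Rabs (clamp 0 L x - clamp 0 L x'))
        <= dl * D) by (apply Rmult_le_compat_l; unfold D; lra).
      lra.
    + apply Rmult_le_compat; try (left; apply Rinv_0_lt_compat; lra);
        apply Rinv_le_contravar; lra.
Qed.

(** The system reads (R_s)_t = - l_s w with w = V_x + s (c/A) A_x, the x-derivative
    of R_s; so along a curve of slope q the derivative of R_s is
    w (1 - l_s q).  It vanishes on the characteristics of the same solution, and
    is small on those of a nearby one. *)
Lemma riemann_along_curve (g Y : R) (H : R -> R) (T L Ae Ve r l0 K dl : R)
  (A V : R -> R -> R) (s : R) (tau : R -> R) (q a b y : R) :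
  0 < T -> 0 < L ->
  s = 1 \/ s = -1 ->
  regular_box g Y H Ae Ve r l0 K -> small_solution g H T L Ae Ve r dl A V ->
  0 <= a -> b <= L ->
  (forall z, Icc a b z -> Icc 0 T (tau z)) -> is_derive tau y q -> Icc a b y ->
  exists w, Rabs w <= 2 * K * dl /\
  D_in (fun z => riemann g H Ae s (A (tau z) z) (V (tau z) z))
    (fun _ => w * (1 - speed g H s (A (tau y) y) (V (tau y) y) * q)) (Icc a b) y.
Proof.
  intros hT hL hs RB SS ha hb Hc Hq hy.
  assert (hp : rect T L (tau y, y))
    by (split; [apply Hc; exact hy|destruct hy; split; simpl; lra]).
  assert (DA := D_in_along_curve T L A tau q a b y hT hL ha hb (ss_A SS) Hc Hq hy).
  assert (DV := D_in_along_curve T L V tau q a b y hT hL ha hb (ss_V SS) Hc Hq hy).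
  destruct (ss_eq SS _ _ hp) as [e1 e2].
  destruct (ss_box SS _ _ hp) as [hbA _].
  destruct (ss_small SS _ _ hp) as [_ [hAx [_ hVx]]].
  assert (hpos := rb_area RB _ hbA).
  assert (hK := rb_K RB).
  assert (hsl := rb_slope RB _ hbA).
  assert (hc2 := rb_celerity_sq RB _ hbA).
  set (A0 := A (tau y) y) in *. set (V0 := V (tau y) y) in *.
  set (At := Dt T A (tau y) y) in *. set (Vt := Dt T V (tau y) y) in *.
  set (Ax := Dx L A (tau y) y) in *. set (Vx := Dx L V (tau y) y) in *.
  set (c := celerity g H A0) in *.
  exists (Vx + s * (c / A0 * Ax)). split.
  - apply Rle_trans with (1 := Rabs_triang _ _).
    assert (es : Rabs s = 1) by (destruct hs as [-> | ->]; [apply Rabs_R1|apply Rabs_m1]).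
    rewrite (Rabs_mult s), es, Rabs_mult.
    assert (h1 : Rabs (c / A0) * Rabs Ax <= K * dl)
      by (apply Rmult_le_compat; try apply Rabs_pos; assumption).
    assert (h2 := Rabs_pos Vx).
    assert (h3 : 1 * dl <= K * dl) by (apply Rmult_le_compat_r; lra).
    lra.
  - assert (DP := D_in_comp a b (fun z => A (tau z) z) _ (potential g H Ae) _ y DA
      (rb_potential RB _ hbA)).
    fold A0 c in DP.
    assert (DR := D_in_plus a b (fun z => V (tau z) z) _ _ _ y DV
      (D_in_mult a b (fun _ => s) 0 _ _ y (D_in_const a b s y) DP)).
    unfold riemann.
    replace ((Vx + s * (c / A0 * Ax)) * (1 - speed g H s A0 V0 * q))
      with (Vt * q + Vx + (0 * potential g H Ae A0 + s * (c / A0 * (At * q + Ax))));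
      [exact DR|].
    assert (eA : At = - (V0 * Ax + A0 * Vx)) by lra.
    (* c^2 = g A H'(A) makes V_x and A_x combine into w. *)
    assert (eV : Vt = - (V0 * Vx + c * c / A0 * Ax)).
    { replace (c * c / A0) with (g * Derive H A0) by (rewrite hc2; field; lra). lra. }
    rewrite eA, eV. unfold speed. fold c.
    destruct hs as [-> | ->]; field; lra.
Qed.

(** * Estimates along characteristics *)

Lemma slope_field_rect g H T L s A V t x : rect T L (t, x) ->
  slope_field g H T L s A V t x = / speed g H s (A t x) (V t x).
Proof.
  intros [ht hx]. unfold slope_field. rewrite !clamp_id by assumption. reflexivity.
Qed.

Lemma crossing_time L T l0 : 0 < T -> 0 < L -> L / T < l0 -> 0 < l0 /\ / l0 * L < T.
Proof.
  intros hT hL h.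
  assert (hl : 0 < l0) by (apply Rlt_trans with (2 := h); apply Rdiv_lt_0_compat; lra).
  split; [exact hl|].
  apply Rmult_lt_reg_l with (l0 / T); [apply Rdiv_lt_0_compat; lra|].
  replace (l0 / T * (/ l0 * L)) with (L / T) by (field; lra).
  replace (l0 / T * T) with l0 by (field; lra). exact h.
Qed.

(** On a characteristic of (A,V), where q = 1 / l_s, only the invariant of
    (A',V') varies, at the rate w' (1 - l_s' / l_s) = w' (l_s - l_s') / l_s. *)
Lemma difference_along_characteristic (g Y : R) (H : R -> R)
  (T L Ae Ve r l0 K dl dl' F s p q : R) (A V A' V' : R -> R -> R) (tau : R -> R) :
  0 < T -> 0 < L ->
  s = 1 \/ s = -1 ->
  regular_box g Y H Ae Ve r l0 K -> 0 < l0 ->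
  small_solution g H T L Ae Ve r dl A V -> small_solution g H T L Ae Ve r dl' A' V' ->
  (forall t x, rect T L (t, x) ->
     Rabs (A t x - A' t x) + Rabs (V t x - V' t x) <= F) ->
  0 <= p -> q <= L ->
  (forall y, Icc p q y -> Icc 0 T (tau y)) ->
  (forall y, Icc p q y -> is_derive tau y (slope_field g H T L s A V (tau y) y)) ->
  forall x e, Icc p q x -> Icc p q e ->
    Rabs ((riemann g H Ae s (A (tau x) x) (V (tau x) x)
           - riemann g H Ae s (A' (tau x) x) (V' (tau x) x))
        - (riemann g H Ae s (A (tau e) e) (V (tau e) e)
           - riemann g H Ae s (A' (tau e) e) (V' (tau e) e)))
      <= 2 * K * dl' * (K * F / l0) * Rabs (x - e).
Proof.
  intros hT hL hs RB hl SS SS' HF hp hq Hreach Htau x e hx he.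
  assert (hK := rb_K RB).
  set (M := 2 * K * dl' * (K * F / l0)).
  set (f := fun y => riemann g H Ae s (A (tau y) y) (V (tau y) y)
    + -1 * riemann g H Ae s (A' (tau y) y) (V' (tau y) y)).
  assert (Hder : forall y, Icc p q y -> exists l, Rabs l <= M /\
    D_in f (fun _ => l) (Icc p q) y).
  { intros y hy.
    assert (hyL : Icc 0 L y) by (destruct hy; split; lra).
    assert (hr : rect T L (tau y, y)) by (split; [apply Hreach; exact hy|exact hyL]).
    assert (Hq := Htau y hy). rewrite slope_field_rect in Hq by exact hr.
    destruct (riemann_along_curve g Y H T L Ae Ve r l0 K dl A V s tau _ p q y
      hT hL hs RB SS hp hq Hreach Hq hy) as [w [_ D]].
    destruct (riemann_along_curve g Y H T L Ae Ve r l0 K dl' A' V' s tau _ p q y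
      hT hL hs RB SS' hp hq Hreach Hq hy) as [w' [hw' D']].
    assert (hsg := rb_speed_sign RB s _ _ hs (ss_box SS _ _ hr)).
    assert (hlp := rb_speed_lip RB s _ _ _ _ hs (ss_box SS _ _ hr) (ss_box SS' _ _ hr)).
    assert (HFy := HF _ _ hr).
    set (l := speed g H s (A (tau y) y) (V (tau y) y)) in *.
    set (l' := speed g H s (A' (tau y) y) (V' (tau y) y)) in *.
    assert (habs : l0 <= Rabs l)
      by (destruct hs as [-> | ->]; [rewrite Rabs_pos_eq|rewrite Rabs_left]; lra).
    assert (hne : l <> 0) by (intro e0; rewrite e0, Rabs_R0 in habs; lra).
    exists (- w' * ((l - l') * / l)). split.
    2:{ replace (- w' * ((l - l') * / l)) with (w * (1 - l * / l)
          + (0 * riemann g H Ae s (A' (tau y) y) (V' (tau y) y)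
             + -1 * (w' * (1 - l' * / l)))) by (field; exact hne).
        exact (D_in_plus p q _ _ _ _ y D
          (D_in_mult p q (fun _ => -1) 0 _ _ y (D_in_const p q (-1) y) D')). }
    rewrite Rabs_mult, Rabs_Ropp. unfold M.
    apply Rmult_le_compat; try apply Rabs_pos; [exact hw'|].
    rewrite Rabs_mult, Rabs_inv.
    apply Rmult_le_compat; try apply Rabs_pos.
    - left; apply Rinv_0_lt_compat; lra.
    - apply Rle_trans with (1 := hlp). apply Rmult_le_compat_l; [lra|exact HFy].
    - apply Rinv_le_contravar; lra. }
  match goal with |- Rabs ?u <= _ => replace u with (f x - f e) by (unfold f; ring) end.
  destruct (Req_dec x e) as [->|hne].
  { rewrite !Rminus_diag, Rabs_R0. lra. }
  assert (hlt : p < q) by (destruct hx, he; lra).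
  apply (D_in_bound_lipschitz p q f (Derive_on p q f)); try assumption.
  - intros y hy. destruct (Hder y hy) as [l [_ D]].
    apply Derive_on_correct; [exact hlt|exact hy|]. exists l; exact D.
  - intros y hy. destruct (Hder y hy) as [l [hlM D]].
    rewrite (Derive_on_unique p q f l y hlt hy D). exact hlM.
Qed.

Lemma between_bounds L x e : Icc 0 L x -> Icc 0 L e ->
  0 <= Rmin x e /\ Rmax x e <= L /\ between x e x /\ between x e e.
Proof.
  intros [h1 h2] [h3 h4]. unfold between, Icc.
  assert (h5 := Rmin_l x e). assert (h6 := Rmin_r x e).
  assert (h7 := Rmax_l x e). assert (h8 := Rmax_r x e).
  repeat split; try assumption; [apply Rmin_glb|apply Rmax_lub]; assumption.
Qed.

(** The characteristic of (A,V) through (t,x) is followed up to a side, where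
    the difference is at most B. *)
Lemma riemann_difference_bound (g Y : R) (H : R -> R) (T L Ae Ve r l0 K dl dl' F B s : R)
  (A V A' V' : R -> R -> R) :
  0 < T -> 0 < L ->
  s = 1 \/ s = -1 ->
  regular_box g Y H Ae Ve r l0 K -> L / T < l0 ->
  small_solution g H T L Ae Ve r dl A V -> 2 * K * dl / (l0 * l0) * L <= / 2 ->
  small_solution g H T L Ae Ve r dl' A' V' ->
  (forall t x, rect T L (t, x) ->
     Rabs (A t x - A' t x) + Rabs (V t x - V' t x) <= F) ->
  (forall t e, Icc 0 T t -> e = 0 \/ e = L ->
     Rabs (riemann g H Ae s (A t e) (V t e) - riemann g H Ae s (A' t e) (V' t e)) <= B) ->
  forall t x, rect T L (t, x) ->
    Rabs (riemann g H Ae s (A t x) (V t x) - riemann g H Ae s (A' t x) (V' t x))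
      <= B + 2 * K * dl' * (K * F / l0) * L.
Proof.
  intros hT hL hs RB hl0 SS hsmall SS' HF HB t x [ht hx]. simpl in ht, hx.
  destruct (crossing_time L T l0 hT hL hl0) as [hl hcross].
  assert (hK := rb_K RB).
  assert (hdl' := small_solution_nonneg _ _ _ _ _ _ _ _ _ _ hT hL SS').
  destruct (slope_field_bounds g Y H T L Ae Ve r l0 K dl A V s hT hL hl hs RB SS)
    as [hk [Hbd Hlip]].
  destruct (characteristic_exists _ _ (/ l0) L t x hx hk hsmall Hlip (fun t x => proj2 (Hbd t x)))
    as [tau [E0 Htau]].
  destruct (reach_side s T L tau (fun y => slope_field g H T L s A V (tau y) y) (/ l0) x
    hs (Rlt_le _ _ hL) hcross Htau (fun y _ => Hbd _ y) hx) as [e [he Hreach]].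
  { rewrite E0. exact ht. }
  assert (heL : Icc 0 L e) by (destruct he as [-> | ->]; split; lra).
  destruct (between_bounds L x e hx heL) as [hp [hq [hpx hpe]]].
  assert (Hf := difference_along_characteristic g Y H T L Ae Ve r l0 K dl dl' F s _ _
    A V A' V' tau hT hL hs RB hl SS SS' HF hp hq Hreach
    ltac:(intros y [hy1 hy2]; apply Htau; split; lra) x e hpx hpe).
  rewrite E0 in Hf.
  assert (hF : 0 <= F).
  { assert (h := HF t x (conj ht hx)).
    assert (h1 := Rabs_pos (A t x - A' t x)). assert (h2 := Rabs_pos (V t x - V' t x)). lra. }
  set (M := 2 * K * dl' * (K * F / l0)) in *.
  assert (hM : 0 <= M).
  { unfold M. apply Rmult_le_pos; [apply Rmult_le_pos; lra|].
    apply Rdiv_le_0_compat; [apply Rmult_le_pos|]; lra. }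
  assert (hxe : M * Rabs (x - e) <= M * L).
  { apply Rmult_le_compat_l; [exact hM|]. destruct hx, heL. apply Rabs_le; lra. }
  assert (hBe := HB (tau e) e (Hreach e hpe) he).
  match goal with |- Rabs ?u <= _ => set (ux := u) in * end.
  match type of hBe with Rabs ?u <= _ => set (ue := u) in * end.
  replace ux with (ue + (ux - ue)) by ring.
  apply Rle_trans with (1 := Rabs_triang _ _). lra.
Qed.

(** The invariant at (0,x) equals the one at the arrival time tau(e) on the side
    x = e, and tau(e) moves by at most (2 / l0) |x - x'|. *)
Lemma initial_riemann_lipschitz (g Y : R) (H : R -> R) (T L Ae Ve r l0 K dl B s : R)
  (A V : R -> R -> R) :
  0 < T -> 0 < L ->
  s = 1 \/ s = -1 ->
  regular_box g Y H Ae Ve r l0 K -> L / T < l0 ->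
  small_solution g H T L Ae Ve r dl A V -> 2 * K * dl / (l0 * l0) * L <= / 2 ->
  0 <= B ->
  (forall t t' e, Icc 0 T t -> Icc 0 T t' -> e = 0 \/ e = L ->
     Rabs (riemann g H Ae s (A t e) (V t e) - riemann g H Ae s (A t' e) (V t' e))
       <= B * Rabs (t - t')) ->
  forall x x', Icc 0 L x -> Icc 0 L x' ->
    Rabs (riemann g H Ae s (A 0 x) (V 0 x) - riemann g H Ae s (A 0 x') (V 0 x'))
      <= B * (2 * / l0 * Rabs (x - x')).
Proof.
  intros hT hL hs RB hl0 SS hsmall hB HB x x' hx hx'.
  destruct (crossing_time L T l0 hT hL hl0) as [hl hcross].
  assert (SE := equilibrium_small_solution g H T L Ae Ve r hT hL (rb_r RB)).
  destruct (slope_field_bounds g Y H T L Ae Ve r l0 K dl A V s hT hL hl hs RB SS)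
    as [hk [Hbd Hlip]].
  set (mu := slope_field g H T L s A V) in *.
  assert (Hm : forall t x, Rabs (mu t x) <= / l0) by (intros; apply Hbd).
  destruct (reach_side_from_start s T L (/ l0) hs (Rlt_le _ _ hL) hcross) as [e [he Hreach]].
  assert (heL : Icc 0 L e) by (destruct he as [-> | ->]; split; lra).
  assert (invariant : forall tau z, Icc 0 L z -> tau z = 0 ->
    (forall y, Icc 0 L y -> is_derive tau y (mu (tau y) y)) ->
    Icc 0 T (tau e) /\ riemann g H Ae s (A 0 z) (V 0 z)
      = riemann g H Ae s (A (tau e) e) (V (tau e) e)).
  { intros tau z hz E0 Htau.
    assert (Hr := Hreach tau (fun y => mu (tau y) y) z Htau (fun y _ => Hbd (tau y) y) hz E0).
    destruct (between_bounds L z e hz heL) as [hp [hq [hpz hpe]]].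
    split; [apply Hr; exact hpe|].
    (* Comparison with the equilibrium, for which dl' = 0: R_s is constant. *)
    assert (h := difference_along_characteristic g Y H T L Ae Ve r l0 K dl 0 (2 * r) s _ _
      A V (fun _ _ => Ae) (fun _ _ => Ve) tau hT hL hs RB hl SS SE
      ltac:(intros t y hy; destruct (ss_box SS t y hy); lra) hp hq Hr
      ltac:(intros y [hy1 hy2]; apply Htau; split; lra) z e hpz hpe).
    rewrite E0, Rmult_0_r, !Rmult_0_l in h. apply Rabs_le_between in h. lra. }
  destruct (characteristic_exists mu _ (/ l0) L 0 x hx hk hsmall Hlip Hm) as [tau [E0 Htau]].
  destruct (characteristic_exists mu _ (/ l0) L 0 x' hx' hk hsmall Hlip Hm)
    as [tau' [E0' Htau']].
  destruct (invariant tau x hx E0 Htau) as [ht ->].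
  destruct (invariant tau' x' hx' E0' Htau') as [ht' ->].
  apply Rle_trans with (1 := HB _ _ e ht ht' he).
  apply Rmult_le_compat_l; [exact hB|].
  exact (characteristic_close mu _ (/ l0) L 0 x x' tau tau' hk hsmall hx hx' Hlip Hm
    E0 E0' Htau Htau' e heL).
Qed.

(** From x = 0 to x = L: states at x = 0 bound S and Q there, the boundary
    conditions carry this bound to S and Q at x = L, and inverting (S,Q) gives
    the states at x = L.  Stated for pairs of states, it applies to two
    solutions, to a solution and the equilibrium, and to one solution at two
    times; K^3 counts the three changes of coordinates. *)
Lemma riemann_at_sides g Y H Ae Ve r l0 K s a0 v0 b0 w0 a1 v1 b1 w1 da dh dq :
  s = 1 \/ s = -1 -> regular_box g Y H Ae Ve r l0 K ->
  box Ae Ve r a0 v0 -> box Ae Ve r b0 w0 -> box Ae Ve r a1 v1 -> box Ae Ve r b1 w1 ->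
  Rabs (a0 - b0) + Rabs (v0 - w0) <= da ->
  Rabs ((S_fun g Y H a0 v0 - S_fun g Y H a1 v1)
      - (S_fun g Y H b0 w0 - S_fun g Y H b1 w1)) <= dh ->
  Rabs ((discharge a0 v0 - discharge a1 v1) - (discharge b0 w0 - discharge b1 w1)) <= dq ->
  Rabs (riemann g H Ae s a0 v0 - riemann g H Ae s b0 w0) <= K ^ 3 * (da + dh + dq) /\
  Rabs (riemann g H Ae s a1 v1 - riemann g H Ae s b1 w1) <= K ^ 3 * (da + dh + dq).
Proof.
  intros hs RB h0 h0' h1 h1' hda hdh hdq.
  assert (hK := rb_K RB).
  set (N := da + dh + dq).
  assert (hp : 0 <= da /\ 0 <= dh /\ 0 <= dq).
  { repeat split.
    - apply Rle_trans with (2 := hda).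
      assert (h := Rabs_pos (a0 - b0)). assert (h' := Rabs_pos (v0 - w0)). lra.
    - apply Rle_trans with (2 := hdh). apply Rabs_pos.
    - apply Rle_trans with (2 := hdq). apply Rabs_pos. }
  assert (hKd : forall x, 0 <= x -> x <= K * x).
  { intros x hx. assert (h := Rmult_le_compat_r x 1 K hx hK). lra. }
  assert (h2 := rb_riemann_lip RB s _ _ _ _ hs h0 h0').
  assert (h3 := rb_riemann_lip RB s _ _ _ _ hs h1 h1').
  assert (h4 := rb_SQ_lip RB _ _ _ _ h0 h0').
  assert (h5 := rb_SQ_inv RB _ _ _ _ h1 h1').
  assert (h6 : K * (Rabs (a0 - b0) + Rabs (v0 - w0)) <= K * da)
    by (apply Rmult_le_compat_l; lra).
  assert (hdaN : K * da <= K * N) by (apply Rmult_le_compat_l; unfold N; lra).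
  assert (hN : 0 <= N) by (unfold N; lra).
  assert (hKN : 0 <= K * N) by (apply Rmult_le_pos; lra).
  assert (h7 : K * N <= K ^ 3 * N).
  { replace (K ^ 3 * N) with (K * (K * (K * N))) by ring.
    apply Rle_trans with (1 := hKd _ hKN). apply hKd. apply Rmult_le_pos; lra. }
  split; [lra|].
  apply Rle_trans with (1 := h3).
  replace (K ^ 3 * N) with (K * (K * (K * N))) by ring.
  apply Rmult_le_compat_l; [lra|]. apply Rle_trans with (1 := h5).
  apply Rmult_le_compat_l; [lra|].
  set (S0 := S_fun g Y H a0 v0) in *. set (S1 := S_fun g Y H a1 v1) in *.
  set (S0' := S_fun g Y H b0 w0) in *. set (S1' := S_fun g Y H b1 w1) in *.
  set (Q0 := discharge a0 v0) in *. set (Q1 := discharge a1 v1) in *.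
  set (Q0' := discharge b0 w0) in *. set (Q1' := discharge b1 w1) in *.
  assert (h8 : Rabs (S1 - S1') <= Rabs (S0 - S0') + dh).
  { replace (S1 - S1') with ((S0 - S0') + - ((S0 - S1) - (S0' - S1'))) by ring.
    apply Rle_trans with (1 := Rabs_triang _ _). rewrite Rabs_Ropp. lra. }
  assert (h9 : Rabs (Q1 - Q1') <= Rabs (Q0 - Q0') + dq).
  { replace (Q1 - Q1') with ((Q0 - Q0') + - ((Q0 - Q1) - (Q0' - Q1'))) by ring.
    apply Rle_trans with (1 := Rabs_triang _ _). rewrite Rabs_Ropp. lra. }
  assert (h10 := hKd dh ltac:(tauto)). assert (h11 := hKd dq ltac:(tauto)).
  unfold N. lra.
Qed.

Lemma time_exceeds_crossing L T l1 l2 : 0 < L -> l1 < 0 -> 0 < l2 ->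
  T > L * Rmax (1 / Rabs l1) (1 / l2) -> 0 < T /\ L / T < - l1 /\ L / T < l2.
Proof.
  intros hL h1 h2 hT. rewrite Rabs_left in hT by exact h1.
  assert (E : forall l, 0 < l -> 1 / l <= Rmax (1 / - l1) (1 / l2) -> 0 < T /\ L / T < l).
  { intros l hl hle.
    assert (h3 : L / l < T).
    { apply Rle_lt_trans with (2 := hT). unfold Rdiv at 1.
      apply Rmult_le_compat_l; lra. }
    assert (h4 : 0 < L / l) by (apply Rdiv_lt_0_compat; lra).
    split; [lra|].
    apply Rmult_lt_reg_l with (T / l); [apply Rdiv_lt_0_compat; lra|].
    replace (T / l * (L / T)) with (L / l) by (field; lra).
    replace (T / l * l) with T by (field; lra). exact h3. }
  destruct (E (- l1)) as [ht hl1]; [lra|apply Rmax_l|].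
  destruct (E l2 h2) as [_ hl2]; [apply Rmax_r|]. tauto.
Qed.

(** * Observability *)

Theorem theorem4p3 (g Y L T : R) (H : R -> R) (Ae Ve : R)
  (hg : 0 < g) (hL : 0 < L)
  (hH : forall a, 0 < a ->
     ex_derive H a /\ continuous (Derive H) a /\ 0 < Derive H a)
  (hHlip : exists r k, 0 < r /\
     forall a b, Rabs (a - Ae) <= r -> Rabs (b - Ae) <= r ->
       Rabs (Derive H a - Derive H b) <= k * Rabs (a - b))
  (hAe : 0 < Ae)
  (hsub : Ve ^ 2 < g * Ae * Derive H Ae)
  (hT : T > L * Rmax (1 / Rabs (lambda1 g H Ae Ve)) (1 / lambda2 g H Ae Ve)) :
  exists delta eps C : R, 0 < delta /\ 0 < eps /\ 0 < C /\
  (forall (h hb A0 V0 A0' V0' : R -> R) (A V A' V' : R -> R -> R),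
     small_compatible_data g Y L T H Ae Ve eps A0 V0 h hb ->
     mixed_problem_solution g Y L T H A0 V0 h hb A V ->
     C1_close T L Ae Ve delta A V ->
     small_compatible_data g Y L T H Ae Ve eps A0' V0' h hb ->
     mixed_problem_solution g Y L T H A0' V0' h hb A' V' ->
     C1_close T L Ae Ve delta A' V' ->
     (forall t, Icc 0 T t -> A t 0 = A' t 0 /\ V t 0 = V' t 0) ->
     forall x, Icc 0 L x -> A0 x = A0' x /\ V0 x = V0' x) /\
  (forall (h hb A0 V0 : R -> R) (A V : R -> R -> R),
     small_compatible_data g Y L T H Ae Ve eps A0 V0 h hb ->
     mixed_problem_solution g Y L T H A0 V0 h hb A V ->
     C1_close T L Ae Ve delta A V ->
     norm_C1_2 0 L (fun x => A0 x - Ae) (fun x => V0 x - Ve) <=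
       C * (norm_C1_2 0 T (fun t => A t 0 - Ae) (fun t => V t 0 - Ve)
            + norm_C1_2 0 T h hb)).
Proof.
  assert (hspeeds : lambda1 g H Ae Ve < 0 /\ 0 < lambda2 g H Ae Ve).
  { assert (hc := sqrt_lt_1_alt (Ve ^ 2) _ (conj (pow2_ge_0 Ve) hsub)).
    rewrite <- Rsqr_pow2, sqrt_Rsqr_abs in hc.
    assert (h1 := Rle_abs Ve). assert (h2 := Rle_abs (- Ve)). rewrite Rabs_Ropp in h2.
    unfold lambda1, lambda2. lra. }
  destruct hspeeds as [hl1 hl2].
  destruct (time_exceeds_crossing L T _ _ hL hl1 hl2 hT) as [hT0 [hnu1 hnu2]].
  destruct (regular_box_exists g Y H Ae Ve (L / T) hg hH hHlip hAe hsub hnu1 hnu2)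
    as [r [l0 [K [hl0 RB]]]].
  assert (hLT : 0 < L / T) by (apply Rdiv_lt_0_compat; lra).
  assert (hK := rb_K RB). assert (hr := rb_r RB).
  assert (hK3 : 0 < K ^ 3) by (apply pow_lt; lra).
  (* The second bound makes the Picard iteration contract, the third one halves
     the difference of two solutions with the same observation. *)
  set (delta := Rmin r (Rmin (l0 * l0 / (4 * K * L)) (l0 / (8 * K ^ 3 * L)))).
  assert (hd1 : 0 < l0 * l0 / (4 * K * L))
    by (apply Rdiv_lt_0_compat; [nra|apply Rmult_lt_0_compat; lra]).
  assert (hd2 : 0 < l0 / (8 * K ^ 3 * L))
    by (apply Rdiv_lt_0_compat; [lra|apply Rmult_lt_0_compat; lra]).
  assert (hdelta : 0 < delta) by (repeat apply Rmin_glb_lt; assumption).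
  assert (hdr : delta <= r) by apply Rmin_l.
  assert (hda : 2 * K * delta / (l0 * l0) * L <= / 2).
  { assert (h : delta <= l0 * l0 / (4 * K * L))
      by (apply Rle_trans with (1 := Rmin_r _ _); apply Rmin_l).
    replace (/ 2) with (2 * K * L / (l0 * l0) * (l0 * l0 / (4 * K * L))) by (field; lra).
    replace (2 * K * delta / (l0 * l0) * L) with (2 * K * L / (l0 * l0) * delta)
      by (field; lra).
    apply Rmult_le_compat_l; [|exact h].
    apply Rdiv_le_0_compat; [apply Rmult_le_pos; lra|nra]. }
  assert (hdb : 4 * K ^ 3 * delta * L / l0 <= / 2).
  { assert (h : delta <= l0 / (8 * K ^ 3 * L))
      by (apply Rle_trans with (1 := Rmin_r _ _); apply Rmin_r).
    replace (/ 2) with (4 * K ^ 3 * L / l0 * (l0 / (8 * K ^ 3 * L))) by (field; lra).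
    replace (4 * K ^ 3 * delta * L / l0) with (4 * K ^ 3 * L / l0 * delta)
      by (field; lra).
    apply Rmult_le_compat_l; [|exact h].
    apply Rdiv_le_0_compat; [apply Rmult_le_pos|]; lra. }
  assert (hK4 : 0 < K ^ 4) by (apply pow_lt; lra).
  assert (hil0 : 0 < / l0) by (apply Rinv_0_lt_compat; lra).
  (* The two terms of C come from the sup bound and from the Lipschitz bound at
     t = 0. *)
  set (C := 4 * K ^ 4 + 8 * K ^ 4 * / l0).
  assert (hC1 : 0 < K ^ 4 * / l0) by (apply Rmult_lt_0_compat; assumption).
  exists delta, 1, C. split; [exact hdelta|]. split; [lra|].
  split; [unfold C; lra|].
  assert (h0T : Icc 0 T 0) by (split; lra).
  assert (h0L : Icc 0 L 0) by (split; lra).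
  assert (hLL : Icc 0 L L) by (split; lra).
  assert (inv : forall a v b w B, box Ae Ve r a v -> box Ae Ve r b w ->
    (forall s, s = 1 \/ s = -1 ->
       Rabs (riemann g H Ae s a v - riemann g H Ae s b w) <= B) ->
    Rabs (a - b) + Rabs (v - w) <= 2 * K * B).
  { intros a v b w B h1 h2 hB. apply Rle_trans with (1 := rb_riemann_inv RB _ _ _ _ h1 h2).
    replace (2 * K * B) with (K * (B + B)) by ring.
    apply Rmult_le_compat_l; [lra|]. apply Rplus_le_compat; apply hB; tauto. }
  split.
  - intros h hb A0 V0 A0' V0' A V A' V' _ Hmix Hclose _ Hmix' Hclose' Hobs.
    assert (SS := small_solution_of_mixed _ _ _ _ _ _ _ _ _ _ _ _ _ _ _ hL hT0 hH Hmix Hclose hdr).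
    assert (SS' := small_solution_of_mixed _ _ _ _ _ _ _ _ _ _ _ _ _ _ _ hL hT0 hH Hmix' Hclose' hdr).
    destruct Hmix as [_ [_ [_ [Hini Hbd]]]]. destruct Hmix' as [_ [_ [_ [Hini' Hbd']]]].
    assert (sides : forall s, s = 1 \/ s = -1 -> forall t e, Icc 0 T t -> e = 0 \/ e = L ->
      Rabs (riemann g H Ae s (A t e) (V t e) - riemann g H Ae s (A' t e) (V' t e)) <= 0).
    { intros s hs t e ht he.
      destruct (Hbd t ht) as [e1 e2]. destruct (Hbd' t ht) as [e1' e2'].
      destruct (Hobs t ht) as [o1 o2].
      destruct (riemann_at_sides g Y H Ae Ve r l0 K s _ _ _ _ _ _ _ _ 0 0 0 hs RB
        (ss_box SS t 0 (conj ht h0L)) (ss_box SS' t 0 (conj ht h0L))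
        (ss_box SS t L (conj ht hLL)) (ss_box SS' t L (conj ht hLL))) as [k1 k2].
      - rewrite o1, o2, !Rminus_diag, Rabs_R0. lra.
      - rewrite e1, e1', Rminus_diag, Rabs_R0. lra.
      - unfold discharge. rewrite e2, e2', Rminus_diag, Rabs_R0. lra.
      - rewrite !Rplus_0_r, Rmult_0_r in k1, k2. destruct he as [-> | ->]; assumption. }
    assert (halving : forall n t x, rect T L (t, x) ->
      Rabs (A t x - A' t x) + Rabs (V t x - V' t x) <= 4 * delta * (/ 2) ^ n).
    { induction n as [|n IH]; intros t x hp.
      - destruct Hclose as [HA HV]. destruct Hclose' as [HA' HV'].
        destruct (C1_rect_close T L A Ae delta hT0 hL (ss_A SS) HA t x hp) as [c1 _].
        destruct (C1_rect_close T L V Ve delta hT0 hL (ss_V SS) HV t x hp) as [c2 _].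
        destruct (C1_rect_close T L A' Ae delta hT0 hL (ss_A SS') HA' t x hp) as [c3 _].
        destruct (C1_rect_close T L V' Ve delta hT0 hL (ss_V SS') HV' t x hp) as [c4 _].
        apply Rabs_le_between in c1, c2, c3, c4.
        assert (k1 : Rabs (A t x - A' t x) <= 2 * delta) by (apply Rabs_le; lra).
        assert (k2 : Rabs (V t x - V' t x) <= 2 * delta) by (apply Rabs_le; lra).
        simpl. lra.
      - set (F := 4 * delta * (/ 2) ^ n) in *.
        assert (hF : 0 <= F) by (apply Rmult_le_pos; [lra|apply pow_le; lra]).
        apply Rle_trans with (2 * K * (0 + 2 * K * delta * (K * F / l0) * L)).
        + apply (inv _ _ _ _ _ (ss_box SS _ _ hp) (ss_box SS' _ _ hp)).
          intros s hs.
          exact (riemann_difference_bound g Y H T L Ae Ve r l0 K delta delta F 0 s A V A' V'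
            hT0 hL hs RB hl0 SS hda SS' IH (sides s hs) t x hp).
        + replace (2 * K * (0 + 2 * K * delta * (K * F / l0) * L))
            with (4 * K ^ 3 * delta * L / l0 * F) by (field; lra).
          apply Rle_trans with (/ 2 * F); [apply Rmult_le_compat_r; assumption|].
          unfold F. simpl. right; ring. }
    intros x hx.
    destruct (Hini x hx) as [<- <-]. destruct (Hini' x hx) as [<- <-].
    assert (h2 := fun n => halving n 0 x (conj h0T hx)).
    assert (h3 := Rabs_pos (A 0 x - A' 0 x)). assert (h4 := Rabs_pos (V 0 x - V' 0 x)).
    split; apply Rminus_diag_uniq; apply le_half_pow_eq0 with (4 * delta);
      intros n; assert (h5 := h2 n); lra.
  - intros h hb A0 V0 A V Hdata Hmix Hclose.
    assert (SS := small_solution_of_mixed _ _ _ _ _ _ _ _ _ _ _ _ _ _ _ hL hT0 hH Hmix Hclose hdr).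
    assert (SE := equilibrium_small_solution g H T L Ae Ve r hT0 hL hr).
    destruct Hmix as [_ [_ [_ [Hini Hbd]]]].
    destruct Hdata as [CA0 [CV0 [Ch [Chb _]]]].
    set (N1 := norm_C1_2 0 T (fun t => A t 0 - Ae) (fun t => V t 0 - Ve)).
    set (N2 := norm_C1_2 0 T h hb).
    assert (NA : norm_C1 0 T (fun t => A t 0 - Ae) <= N1) by apply Rmax_l.
    assert (NV : norm_C1 0 T (fun t => V t 0 - Ve) <= N1) by apply Rmax_r.
    assert (Nh : norm_C1 0 T h <= N2) by apply Rmax_l.
    assert (Nhb : norm_C1 0 T hb <= N2) by apply Rmax_r.
    assert (obs : forall f N t t', C1 0 T f -> norm_C1 0 T f <= N ->
      Icc 0 T t -> Icc 0 T t' ->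
      Rabs (f t) <= N /\ Rabs (f t - f t') <= N * Rabs (t - t')).
    { intros f N t t' hf hN ht ht'. destruct (C1_sup T f hT0 hf t t' ht ht') as [k1 k2].
      split; [lra|]. apply Rle_trans with (1 := k2).
      apply Rmult_le_compat_r; [apply Rabs_pos|exact hN]. }
    assert (SA := C1_rect_side T L A Ae 0 hT0 h0L (ss_A SS)).
    assert (SV := C1_rect_side T L V Ve 0 hT0 h0L (ss_V SS)).
    set (N := N1 + N2).
    assert (hN : 0 <= N).
    { destruct (obs _ N1 0 0 SA NA h0T h0T) as [k1 _].
      destruct (obs _ N2 0 0 Ch Nh h0T h0T) as [k2 _].
      assert (k3 := Rabs_pos (A 0 0 - Ae)). assert (k4 := Rabs_pos (h 0)). unfold N. lra. }
    set (B := 2 * K ^ 3 * N).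
    assert (hB : 0 <= B) by (apply Rmult_le_pos; lra).
    assert (sides0 : forall s, s = 1 \/ s = -1 -> forall t e, Icc 0 T t -> e = 0 \/ e = L ->
      Rabs (riemann g H Ae s (A t e) (V t e) - riemann g H Ae s Ae Ve) <= B).
    { intros s hs t e ht he.
      destruct (Hbd t ht) as [e1 e2].
      destruct (riemann_at_sides g Y H Ae Ve r l0 K s _ _ _ _ _ _ _ _ (2 * N1) N2 N2 hs RB
        (ss_box SS t 0 (conj ht h0L)) (ss_box SE t 0 (conj ht h0L))
        (ss_box SS t L (conj ht hLL)) (ss_box SE t L (conj ht hLL))) as [k1 k2].
      - destruct (obs _ N1 t t SA NA ht ht) as [k1 _].
        destruct (obs _ N1 t t SV NV ht ht) as [k2 _]. lra.
      - rewrite e1, Rminus_diag, Rminus_0_r. apply (obs _ N2 t t Ch Nh ht ht).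
      - unfold discharge. rewrite e2, Rminus_diag, Rminus_0_r.
        apply (obs _ N2 t t Chb Nhb ht ht).
      - replace B with (K ^ 3 * (2 * N1 + N2 + N2)) by (unfold B, N; ring).
        destruct he as [-> | ->]; assumption. }
    assert (sides1 : forall s, s = 1 \/ s = -1 -> forall t t' e, Icc 0 T t -> Icc 0 T t' ->
      e = 0 \/ e = L ->
      Rabs (riemann g H Ae s (A t e) (V t e) - riemann g H Ae s (A t' e) (V t' e))
        <= B * Rabs (t - t')).
    { intros s hs t t' e ht ht' he.
      destruct (Hbd t ht) as [e1 e2]. destruct (Hbd t' ht') as [e1' e2'].
      set (D := Rabs (t - t')).
      destruct (riemann_at_sides g Y H Ae Ve r l0 K s _ _ _ _ _ _ _ _
        (2 * N1 * D) (N2 * D) (N2 * D) hs RB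
        (ss_box SS t 0 (conj ht h0L)) (ss_box SS t' 0 (conj ht' h0L))
        (ss_box SS t L (conj ht hLL)) (ss_box SS t' L (conj ht' hLL))) as [k1 k2].
      - destruct (obs _ N1 t t' SA NA ht ht') as [_ k1].
        destruct (obs _ N1 t t' SV NV ht ht') as [_ k2].
        replace (A t 0 - Ae - (A t' 0 - Ae)) with (A t 0 - A t' 0) in k1 by ring.
        replace (V t 0 - Ve - (V t' 0 - Ve)) with (V t 0 - V t' 0) in k2 by ring.
        fold D in k1, k2. lra.
      - rewrite e1, e1'. apply (obs _ N2 t t' Ch Nh ht ht').
      - unfold discharge. rewrite e2, e2'. apply (obs _ N2 t t' Chb Nhb ht ht').
      - replace (B * D) with (K ^ 3 * (2 * N1 * D + N2 * D + N2 * D)) by (unfold B, N; ring).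
        destruct he as [-> | ->]; assumption. }
    assert (hini : forall x, Icc 0 L x -> box Ae Ve r (A0 x) (V0 x)).
    { intros x hx. destruct (Hini x hx) as [<- <-]. apply (ss_box SS); split; assumption. }
    assert (est0 : forall x, Icc 0 L x -> Rabs (A0 x - Ae) + Rabs (V0 x - Ve) <= C * N).
    { intros x hx. destruct (Hini x hx) as [<- <-].
      assert (hp : rect T L (0, x)) by (split; assumption).
      apply Rle_trans with (2 * K * B).
      - apply (inv _ _ _ _ _ (ss_box SS _ _ hp) (ss_box SE _ _ hp)).
        intros s hs.
        assert (k := riemann_difference_bound g Y H T L Ae Ve r l0 K delta 0 (2 * r) B s
          A V (fun _ _ => Ae) (fun _ _ => Ve) hT0 hL hs RB hl0 SS hda SE).
        rewrite Rmult_0_r, !Rmult_0_l, Rplus_0_r in k.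
        apply k; [|exact (sides0 s hs)|exact hp].
        intros t y hy. destruct (ss_box SS t y hy). lra.
      - replace (2 * K * B) with (4 * K ^ 4 * N) by (unfold B; ring).
        apply Rmult_le_compat_r; [exact hN|]. unfold C. lra. }
    assert (est1 : forall x x', Icc 0 L x -> Icc 0 L x' ->
      Rabs (A0 x - A0 x') + Rabs (V0 x - V0 x') <= C * N * Rabs (x - x')).
    { intros x x' hx hx'. destruct (Hini x hx) as [<- <-]. destruct (Hini x' hx') as [<- <-].
      apply Rle_trans with (2 * K * (B * (2 * / l0 * Rabs (x - x')))).
      - apply (inv _ _ _ _ _ (ss_box SS 0 x (conj h0T hx)) (ss_box SS 0 x' (conj h0T hx'))).
        intros s hs.
        exact (initial_riemann_lipschitz g Y H T L Ae Ve r l0 K delta B s A V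
          hT0 hL hs RB hl0 SS hda hB (sides1 s hs) x x' hx hx').
      - replace (2 * K * (B * (2 * / l0 * Rabs (x - x'))))
          with (8 * K ^ 4 * / l0 * N * Rabs (x - x')) by (unfold B; ring).
        apply Rmult_le_compat_r; [apply Rabs_pos|].
        apply Rmult_le_compat_r; [exact hN|]. unfold C. lra. }
    fold N. apply Rmax_lub; apply norm_C1_le; try exact hL;
      try (apply C1_shift; assumption).
    + intros x hx. assert (k := est0 x hx). assert (k' := Rabs_pos (V0 x - Ve)). lra.
    + intros x y hx hy. assert (k := est1 y x hy hx).
      assert (k' := Rabs_pos (V0 y - V0 x)).
      replace (A0 y - Ae - (A0 x - Ae)) with (A0 y - A0 x) by ring. lra.
    + intros x hx. assert (k := est0 x hx). assert (k' := Rabs_pos (A0 x - Ae)). lra.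
    + intros x y hx hy. assert (k := est1 y x hy hx).
      assert (k' := Rabs_pos (A0 y - A0 x)).
      replace (V0 y - Ve - (V0 x - Ve)) with (V0 y - V0 x) by ring. lra.
Qed.
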